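(* Let $H$ be a stable $n$-th order LTI model in diagonal canonical form $H(s)=C_\Delta(sI_n-\Delta)^{-1}B_\Delta+D=D+\sum_{i=1}^n\frac{\Phi_i}{s-\lambda_i}$ and let $0<r<n$. For $\alpha\in\{0,1\}^n$ and $D_\alpha\in\mathbb{R}^{n_y\times n_u}$ let $H_\alpha(s)=D_\alpha+\sum_{i=1}^n\alpha_i\frac{\Phi_i}{s-\lambda_i}$ and consider the complex diagonal form of the approximation error $E_\alpha=H-H_\alpha$: $$A_e=\Delta,\quad B_e=B_\Delta,\quad C_e=C_\Delta\Delta_\alpha,\quad D_e=D-D_\alpha,\qquad \Delta_\alpha=I_n-\mathrm{diag}(\alpha_1,\ldots,\alpha_n).$$ Then the $r$-th order optimal $\mathcal{H}_\infty$ modal truncation model $H_\alpha^\star$, i.e. the solution of $$\min_{\alpha,D_\alpha}\ \Vert H-H_\alpha\Vert_\infty\quad\text{s.t.}\quad\alpha\in\{0,1\}^n,\ D_\alpha\in\mathbb{R}^{n_y\times n_u},\ \mathbf{1}^T\alpha=r,\ M\alpha=0,$$ is given by the solution of the following mixed semidefinite program: $$\min_{\gamma,P,\alpha,D_\alpha}\ \gamma\quad\text{s.t.}\quad\alpha\in\{0,1\}^n,\ D_\alpha\in\mathbb{R}^{n_y\times n_u},\ \gamma\in\mathbb{R}_+,\ P\in\mathbb{S}^n_{++},\ \mathbf{1}^T\alpha=r,\ M\alpha=0,\ M_e(\alpha)\prec0,$$ where the last constraint is a linear matrix inequality characterised by the matrix $$M_e(\alpha)=\begin{bmatrix}A_e^TP+PA_e&PB_e&C_e^T\\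 \star&-\gamma I&D_e^T\\ \star&\star&-\gamma I\end{bmatrix}.$$
   Context: Setting. $H$ is the LTI model $\dot x=Ax+Bu$, $y=Cx+Du$ with real matrices $A\in\mathbb{R}^{n\times n}$, $B\in\mathbb{R}^{n\times n_u}$, $C\in\mathbb{R}^{n_y\times n}$, $D\in\mathbb{R}^{n_y\times n_u}$, identified with its transfer function $H(s)=C(sI-A)^{-1}B+D$. It is stable (all eigenvalues of $A$ lie in the open left half-plane) and $A$ has semi-simple eigenvalues $\lambda_1,\dots,\lambda_n$. With $AX=X\Delta$, $\Delta=\mathrm{diag}(\lambda_1,\dots,\lambda_n)$, $X$ the invertible matrix of right eigenvectors, $B_\Delta=X^{-1}B$, $C_\Delta=CX$, the residues are $\Phi_i=C_\Delta e_ie_i^TB_\Delta\in\mathbb{C}^{n_y\times n_u}$ ($e_i$ the $i$-th canonical basis vector), which gives the diagonal canonical form. Conjugate pairs. Each non-real pole-residue pair comes with its complex conjugate; there are $n_c$ such conjugate pairs of indices $\{i,j\}$, with $\mathrm{Im}(\lambda_i)>0$ and $\lambda_j$ the complex conjugate of $\lambda_i$. $M\in\mathbb{R}^{n_c\times n}$ has one row per pair $\{i,j\}$, with entry $1$ in column $i$, $-1$ in column $j$ and $0$ elsewhere; thus $M\alpha=0$ means $\alpha_i=\alpha_j$ for every pair, so that $H_\alpha$ has a real realisation. Notation. $\mathbf{1}\in\mathbb{R}^n$ is the all-ones vector; $^T$ is the transpose; $\mathbb{R}_+$ is the set of positive numbers; $\mathbb{S}^n_{++}$ is the set of symmetric and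 positive definite matrices of size $n$; $\prec0$ means negative definite; $\star$ denotes the blocks deduced by symmetry; the two identity blocks have sizes $n_u$ and $n_y$, respectively. Norm. For a stable $G$, $\Vert G\Vert_\infty=\sup_{\nu\in\mathbb{R}}\sigma_1(G(\imath\nu))$, with $\sigma_1$ the largest singular value and $\imath=\sqrt{-1}$.
   Formalization: On the complex diagonal data, transpose is read as conjugate transpose and P as Hermitian positive definite (with plain transposes M_e is not Hermitian when poles are non-real); the SDP minimum, never attained under strict constraints, is read as an infimum. *)

(* Defs.v *)
From HB Require Import structures.
From mathcomp Require Import all_boot all_order all_algebra.
From mathcomp Require Import complex.
From mathcomp Require Import all_classical all_reals all_analysis.

Set Implicit Arguments.
Unset Strict Implicit.
Unset Printing Implicit Defensive.

Import Order.TTheory GRing.Theory Num.Theory.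

Local Open Scope classical_set_scope.
Local Open Scope ring_scope.
Local Open Scope complex_scope.
Local Open Scope sesquilinear_scope.

Definition mxC (R : realType) (m p : nat) (A : 'M[R]_(m, p)) : 'M[R[i]]_(m, p) :=
  map_mx (real_complex R) A.

Definition transfer (R : realType) (n nu ny : nat) (A : 'M[R[i]]_n)
    (B : 'M[R[i]]_(n, nu)) (C : 'M[R[i]]_(ny, n)) (D : 'M[R[i]]_(ny, nu))
    (s : R[i]) : 'M[R[i]]_(ny, nu) :=
  C *m invmx (s%:M - A) *m B + D.

Definition stable (R : realType) (n : nat) (A : 'M[R[i]]_n) : Prop :=
  forall a : R[i], eigenvalue A a -> complex.Re a < 0.

(* When ny < nu this also counts the zero eigenvalues of G^* G that do not
   come from a singular value of G; they do not affect the largest one. *)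
Definition singular_value (R : realType) (ny nu : nat) (G : 'M[R[i]]_(ny, nu))
    (s : R) : Prop :=
  0 <= s /\ eigenvalue (G^t* *m G) (s ^+ 2)%:C.

(* The set is finite, and it is nonempty as soon as 0 < nu, so that the
   supremum is a maximum; it is 0 when nu = 0. *)
Definition sigma1 (R : realType) (ny nu : nat) (G : 'M[R[i]]_(ny, nu)) : R :=
  sup [set s : R | singular_value G s].

Definition Hinf_norm (R : realType) (ny nu : nat)
    (G : R[i] -> 'M[R[i]]_(ny, nu)) : \bar R :=
  ereal_sup [set (sigma1 (G (0 +i* w)))%:E | w in [set: R]].

Definition residue (R : realType) (n nu ny : nat) (Bd : 'M[R[i]]_(n, nu))
    (Cd : 'M[R[i]]_(ny, n)) (i : 'I_n) : 'M[R[i]]_(ny, nu) :=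
  let e : 'cV[R[i]]_n := delta_mx i 0 in Cd *m e *m e^T *m Bd.

Definition modal_truncation (R : realType) (n nu ny : nat) (lam : 'rV[R[i]]_n)
    (Phi : 'I_n -> 'M[R[i]]_(ny, nu)) (alpha : 'cV[R]_n) (Da : 'M[R]_(ny, nu))
    (s : R[i]) : 'M[R[i]]_(ny, nu) :=
  mxC Da + \sum_(i < n) (alpha i 0)%:C *: ((s - lam 0 i)^-1 *: Phi i).

(* The pairing is a datum because a repeated non-real eigenvalue does not
   determine which index is conjugate to which. *)
Definition conjugate_pairing (R : realType) (n nu ny nc : nat)
    (lam : 'rV[R[i]]_n) (Phi : 'I_n -> 'M[R[i]]_(ny, nu))
    (pr : 'I_nc -> 'I_n * 'I_n) : Prop :=
  [/\ injective (fun k => (pr k).1),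
      injective (fun k => (pr k).2),
      (forall k, 0 < complex.Im (lam 0 (pr k).1)),
      (forall k, lam 0 (pr k).2 = (lam 0 (pr k).1)^* /\
                 Phi (pr k).2 = map_mx conjc (Phi (pr k).1)) &
      (forall i, complex.Im (lam 0 i) != 0 ->
         exists k, i = (pr k).1 \/ i = (pr k).2)].

Definition pair_mx (R : realType) (n nc : nat) (pr : 'I_nc -> 'I_n * 'I_n) :
    'M[R]_(nc, n) :=
  \matrix_(k < nc, i < n) ((i == (pr k).1)%:R - (i == (pr k).2)%:R).

Definition admissible (R : realType) (n nc : nat) (r : nat) (M : 'M[R]_(nc, n))
    (alpha : 'cV[R]_n) : Prop :=
  [/\ (forall i, alpha i 0 = 0 \/ alpha i 0 = 1),
      (const_mx 1 : 'cV[R]_n)^T *m alpha = (r%:R)%:M &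
      M *m alpha = 0].

Definition modal_solution (R : realType) (n nu ny nc r : nat)
    (M : 'M[R]_(nc, n)) (H : R[i] -> 'M[R[i]]_(ny, nu)) (lam : 'rV[R[i]]_n)
    (Phi : 'I_n -> 'M[R[i]]_(ny, nu)) (alpha : 'cV[R]_n) (Da : 'M[R]_(ny, nu)) :
    Prop :=
  let err a D := Hinf_norm (fun s => H s - modal_truncation lam Phi a D s) in
  admissible r M alpha /\
  forall (alpha' : 'cV[R]_n) (Da' : 'M[R]_(ny, nu)),
    admissible r M alpha' -> (err alpha Da <= err alpha' Da')%E.

(* The diagonal form is complex, so that symmetry is Hermitian symmetry and
   matrix inequalities are between Hermitian matrices; this is the usual notion
   on real data. *)
Definition posdef (R : realType) (n : nat) (P : 'M[R[i]]_n) : Prop :=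
  P \is hermsymmx /\
  forall x : 'cV[R[i]]_n, x != 0 -> 0 < (x^t* *m P *m x) 0 0.

Definition negdef (R : realType) (n : nat) (P : 'M[R[i]]_n) : Prop :=
  posdef (- P).

Definition bounded_real_mx (R : realType) (n nu ny : nat)
    (A : 'M[R[i]]_n) (B : 'M[R[i]]_(n, nu)) (C : 'M[R[i]]_(ny, n))
    (D : 'M[R[i]]_(ny, nu)) (g : R) (P : 'M[R[i]]_n) :
    'M[R[i]]_(n + nu + ny) :=
  block_mx
    (block_mx (A^t* *m P + P *m A) (P *m B)
              ((P *m B)^t*)        ((- g)%:C)%:M)
    (col_mx (C^t*) (D^t*))
    (row_mx C D)
    ((- g)%:C)%:M.

Definition error_lmi_mx (R : realType) (n nu ny : nat) (lam : 'rV[R[i]]_n)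
    (Bd : 'M[R[i]]_(n, nu)) (Cd : 'M[R[i]]_(ny, n)) (D : 'M[R]_(ny, nu))
    (alpha : 'cV[R]_n) (Da : 'M[R]_(ny, nu)) (g : R) (P : 'M[R[i]]_n) :
    'M[R[i]]_(n + nu + ny) :=
  let Delta_alpha := 1%:M - diag_mx (mxC alpha)^T in
  bounded_real_mx (diag_mx lam) Bd (Cd *m Delta_alpha) (mxC (D - Da)) g P.

Definition sdp_feasible (R : realType) (n nu ny nc r : nat) (M : 'M[R]_(nc, n))
    (lam : 'rV[R[i]]_n) (Bd : 'M[R[i]]_(n, nu)) (Cd : 'M[R[i]]_(ny, n))
    (D : 'M[R]_(ny, nu)) (g : R) (P : 'M[R[i]]_n) (alpha : 'cV[R]_n)
    (Da : 'M[R]_(ny, nu)) : Prop :=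
  [/\ 0 < g, posdef P, admissible r M alpha &
      negdef (error_lmi_mx lam Bd Cd D alpha Da g P)].

(* The constraints are strict, so the feasible set is open in (g, P) and the
   objective has no minimiser: (g, alpha, Da) is a solution when g is the optimal
   value (infimum over all variables) and when this value is already the infimum
   over the two remaining variables (g, P) at (alpha, Da). *)
Definition sdp_solution (R : realType) (n nu ny nc r : nat) (M : 'M[R]_(nc, n))
    (lam : 'rV[R[i]]_n) (Bd : 'M[R[i]]_(n, nu)) (Cd : 'M[R[i]]_(ny, n))
    (D : 'M[R]_(ny, nu)) (g : R) (alpha : 'cV[R]_n) (Da : 'M[R]_(ny, nu)) :
    Prop :=
  let feasible := sdp_feasible r M lam Bd Cd D in
  g%:E = ereal_inf [set h%:E | h in
           [set h : R | exists P alpha' Da', feasible h P alpha' Da']] /\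
  g%:E = ereal_inf [set h%:E | h in
           [set h : R | exists P, feasible h P alpha Da]].

(* Main.v *)
Require Import Defs.
From mathcomp Require Import all_boot all_order all_algebra.
From mathcomp Require Import complex.
From mathcomp Require Import all_classical all_reals all_analysis.
From mathcomp Require Import ring lra.

(** The error of a modal truncation is a stable diagonal system whose matrices
    B, C, D are arbitrary, so everything reduces to the strict bounded real
    lemma: the LMI is feasible at level g as soon as the H-infinity norm is
    below g, and feasibility at level g bounds the norm by g.  Hence for fixed
    (alpha, D_alpha) the infimum of the feasible g is the norm of the error.

    The hard half of the bounded real lemma follows from a theorem of
    alternatives.  Minimising |F Z Z^* J^* + J Z Z^* F^*|^2 + tr(Z^* Th Z)^2 on
    the sphere of matrices Z either gives the value 0, or the first-order
    condition at the minimiser yields the certificate P.  In the first case Z is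
    decomposed into columns z with J z = 0 or F z = i w J z, that is, into inputs
    at single (possibly infinite) frequencies, where the norm bound makes the
    form negative.  Positivity of P is the Lyapunov inequality, which is
    immediate on eigenvectors of P because the state matrix is diagonal.

    A best D_alpha exists for each alpha since the sublevel sets of the norm are
    compact, and there are finitely many alpha. *)

Set Implicit Arguments.
Unset Strict Implicit.
Unset Printing Implicit Defensive.

Import Order.TTheory GRing.Theory Num.Theory numFieldNormedType.Exports.

Local Open Scope ring_scope.

(** * Complex matrices as a real Euclidean space *)

Section RealInnerProduct.
Local Open Scope classical_set_scope.
Local Open Scope complex_scope.
Local Open Scope sesquilinear_scope.
Context {R : realType}.
Local Notation C := R[i].

Lemma adjmxK m p (A : 'M[C]_(m, p)) : A^t*^t* = A.
Proof. exact: trmxCK. Qed.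

Lemma adjmxM m p q (A : 'M[C]_(m, p)) (B : 'M[C]_(p, q)) :
  (A *m B)^t* = B^t* *m A^t*.
Proof. by rewrite trmx_mul map_mxM. Qed.

Lemma adjmxD m p (A B : 'M[C]_(m, p)) : (A + B)^t* = A^t* + B^t*.
Proof. by rewrite linearD /= map_mxD. Qed.

Lemma adjmxN m p (A : 'M[C]_(m, p)) : (- A)^t* = - A^t*.
Proof. by rewrite linearN /= map_mxN. Qed.

Lemma adjmxZ m p c (A : 'M[C]_(m, p)) : (c *: A)^t* = c^* *: A^t*.
Proof. by rewrite linearZ /= map_mxZ. Qed.

Lemma adjmx_real m p (c : R) (A : 'M[C]_(m, p)) : (c%:C *: A)^t* = c%:C *: A^t*.
Proof. by rewrite adjmxZ; congr (_ *: _); exact: conjc_real. Qed.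

Lemma adj_col_mx m1 m2 p (A : 'M[C]_(m1, p)) (B : 'M[C]_(m2, p)) :
  (col_mx A B)^t* = row_mx (A^t*) (B^t*).
Proof. by rewrite tr_col_mx map_row_mx. Qed.

Lemma ReD (x y : C) : complex.Re (x + y) = complex.Re x + complex.Re y.
Proof. by case: x y => [? ?] []. Qed.

Lemma ReZ (c : R) (x : C) : complex.Re (c%:C * x) = c * complex.Re x.
Proof. by case: x => [? ?] /=; rewrite mul0r subr0. Qed.

Lemma Re_sum I (s : seq I) (P : pred I) (F : I -> C) :
  complex.Re (\sum_(i <- s | P i) F i) = \sum_(i <- s | P i) complex.Re (F i).
Proof. by apply: (big_morph _ ReD). Qed.

(** The Frobenius inner product over the reals: quadratic forms then take values in the ordered
    field [R], and orthogonality of [X] to [i w X] is automatic. *)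
Definition rip m p (X Y : 'M[C]_(m, p)) : R := complex.Re (\tr (X^t* *m Y)).

Lemma ripE m p (X Y : 'M[C]_(m, p)) : rip X Y =
  \sum_i \sum_j (complex.Re (X i j) * complex.Re (Y i j)
               + complex.Im (X i j) * complex.Im (Y i j)).
Proof.
rewrite /rip /mxtrace Re_sum exchange_big /=; apply: eq_bigr => j _.
rewrite mxE Re_sum; apply: eq_bigr => i _; rewrite !mxE.
by case: (X i j) (Y i j) => [a b] [c d] /=; rewrite mulNr opprK.
Qed.

Lemma ripC m p (X Y : 'M[C]_(m, p)) : rip X Y = rip Y X.
Proof. by rewrite !ripE; do 2!apply: eq_bigr => ? _; congr (_ + _); rewrite mulrC. Qed.

Lemma ripDr m p (X Y Z : 'M[C]_(m, p)) : rip X (Y + Z) = rip X Y + rip X Z.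
Proof. by rewrite /rip mulmxDr linearD ReD. Qed.

Lemma ripDl m p (X Y Z : 'M[C]_(m, p)) : rip (X + Y) Z = rip X Z + rip Y Z.
Proof. by rewrite ripC ripDr !(ripC Z). Qed.

Lemma ripZr m p (c : R) (X Y : 'M[C]_(m, p)) : rip X (c%:C *: Y) = c * rip X Y.
Proof. by rewrite /rip -scalemxAr linearZ ReZ. Qed.

Lemma ripZl m p (c : R) (X Y : 'M[C]_(m, p)) : rip (c%:C *: X) Y = c * rip X Y.
Proof. by rewrite ripC ripZr ripC. Qed.

Lemma ripNr m p (X Y : 'M[C]_(m, p)) : rip X (- Y) = - rip X Y.
Proof. by rewrite /rip mulmxN linearN /=; case: (\tr _). Qed.

Lemma ripNl m p (X Y : 'M[C]_(m, p)) : rip (- X) Y = - rip X Y.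
Proof. by rewrite ripC ripNr ripC. Qed.

Lemma ripBr m p (X Y Z : 'M[C]_(m, p)) : rip X (Y - Z) = rip X Y - rip X Z.
Proof. by rewrite ripDr ripNr. Qed.

Lemma ripBl m p (X Y Z : 'M[C]_(m, p)) : rip (X - Y) Z = rip X Z - rip Y Z.
Proof. by rewrite ripDl ripNl. Qed.

Lemma rip0r m p (X : 'M[C]_(m, p)) : rip X 0 = 0.
Proof. by rewrite /rip mulmx0 linear0. Qed.

Lemma rip0l m p (X : 'M[C]_(m, p)) : rip 0 X = 0.
Proof. by rewrite ripC rip0r. Qed.

Lemma rip_mulmxl m p q (A : 'M[C]_(m, p)) (X : 'M[C]_(p, q)) Y :
  rip (A *m X) Y = rip X (A^t* *m Y).
Proof. by rewrite /rip adjmxM mulmxA. Qed.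

Lemma rip_mulmxr m p q (A : 'M[C]_(p, q)) (X : 'M[C]_(m, p)) Y :
  rip (X *m A) Y = rip X (Y *m A^t*).
Proof. by rewrite /rip adjmxM -mulmxA mxtrace_mulC !mulmxA. Qed.

Lemma rip_adj m p (X Y : 'M[C]_(m, p)) : rip (X^t*) (Y^t*) = rip X Y.
Proof.
rewrite !ripE exchange_big /=; do 2!apply: eq_bigr => ? _; rewrite !mxE.
by case: (X _ _) (Y _ _) => [a b] [c d] /=; rewrite mulrNN.
Qed.

(** A quadratic form in [Z] is linear in the Gram matrix [Z Z^*]. Both the minimisation and the
    column splitting below act on Gram matrices only. *)
Lemma rip_gram n p (H : 'M[C]_n) (Z : 'M[C]_(n, p)) :
  rip (H^t*) (Z *m Z^t*) = rip Z (H *m Z).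
Proof. by rewrite /rip adjmxK mulmxA mxtrace_mulC. Qed.

Lemma rip_ge0 m p (X : 'M[C]_(m, p)) : 0 <= rip X X.
Proof. by rewrite ripE; do 2!apply: sumr_ge0 => ? _; rewrite -!expr2 addr_ge0 ?sqr_ge0. Qed.

Lemma rip_eq0 m p (X : 'M[C]_(m, p)) : (rip X X == 0) = (X == 0).
Proof.
apply/eqP/eqP => [|->]; last exact: rip0r.
have ge0 i j : 0 <= complex.Re (X i j) * complex.Re (X i j)
               + complex.Im (X i j) * complex.Im (X i j).
  by rewrite -!expr2 addr_ge0 ?sqr_ge0.
rewrite ripE => /eqP; rewrite psumr_eq0 => [|i _]; last exact: sumr_ge0.
move=> /allP X0; apply/matrixP => i j; rewrite mxE.
have := X0 i (mem_index_enum i); rewrite psumr_eq0// => /allP/(_ j (mem_index_enum j)).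
rewrite /= -!expr2 paddr_eq0 ?sqr_ge0// !sqrf_eq0 => /andP[/eqP a0 /eqP b0].
by apply/eqP; rewrite eq_complex a0 b0 !eqxx.
Qed.

Lemma rip_gt0 m p (X : 'M[C]_(m, p)) : (0 < rip X X) = (X != 0).
Proof. by rewrite lt_def rip_eq0 rip_ge0 andbT. Qed.

Lemma rip_col_mx m1 m2 p (A X : 'M[C]_(m1, p)) (B Y : 'M[C]_(m2, p)) :
  rip (col_mx A B) (col_mx X Y) = rip A X + rip B Y.
Proof. by rewrite /rip adj_col_mx mul_row_col linearD ReD. Qed.

Lemma rip_imag m p (w : R) (X : 'M[C]_(m, p)) : rip X ((0 +i* w) *: X) = 0.
Proof.
rewrite ripE; do 2!apply: big1 => ? _; rewrite mxE.
by case: (X _ _) => a b /=; ring.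
Qed.

Lemma rip_entry m p (X : 'M[C]_(m, p)) i j :
  complex.Re (X i j) ^+ 2 + complex.Im (X i j) ^+ 2 <= rip X X.
Proof.
have ge0 i' j' : 0 <= complex.Re (X i' j') * complex.Re (X i' j')
               + complex.Im (X i' j') * complex.Im (X i' j').
  by rewrite -!expr2 addr_ge0 ?sqr_ge0.
rewrite ripE (bigD1 i)//= (bigD1 j)//= -!expr2 -addrA ler_wpDr//.
by rewrite addr_ge0// !sumr_ge0// => *; rewrite ?sumr_ge0// => *; exact: ge0.
Qed.

Lemma ripCE m (P : 'M[C]_m) (x : 'cV[C]_m) :
  rip x (P *m x) = complex.Re ((x^t* *m P *m x) 0 0).
Proof. by rewrite /rip mulmxA trace_mx11. Qed.

(** The value of a Hermitian form equals its own conjugate, so its imaginary part vanishes and the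
    complex order reduces to the order of real parts. *)
Lemma posdefP m (P : 'M[C]_m) :
  posdef P <-> P^t* = P /\ forall x : 'cV[C]_m, x != 0 -> 0 < rip x (P *m x).
Proof.
rewrite /posdef is_hermitianmxE expr0 scale1r; split.
  by move=> [/eqP/esym h p]; split => // x /p; rewrite ripCE ltcE => /andP[].
move=> [h p]; split; first by rewrite h eqxx.
move=> x /p; rewrite ripCE ltcE => ->; rewrite andbT.
have : (x^t* *m P *m x)^t* = x^t* *m P *m x by rewrite !adjmxM adjmxK h mulmxA.
move/matrixP/(_ 0 0); rewrite !mxE; case: (\sum_j _) => a b /= [] /eqP.
by rewrite eq_sym -subr_eq0 opprK -mulr2n mulrn_eq0 /= => /eqP ->.
Qed.

End RealInnerProduct.

(** * Singular values and the H-infinity norm as gains *)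

Section Gain.
Local Open Scope classical_set_scope.
Local Open Scope complex_scope.
Local Open Scope sesquilinear_scope.
Context {R : realType}.
Local Notation C := R[i].

(** Young's inequality with weight [d]: expand the square of [d X - Y] and divide by [d]. *)
Lemma rip_add_le m p (d : R) (X Y : 'M[C]_(m, p)) : 0 < d ->
  rip (X + Y) (X + Y) <= (1 + d) * rip X X + (1 + d^-1) * rip Y Y.
Proof.
move=> d0; have := rip_ge0 (d%:C *: X - Y).
rewrite !(ripBl, ripBr, ripDl, ripDr, ripZl, ripZr) (ripC Y X) => h.
have : 0 <= d^-1 * (d * (d * rip X X - rip X Y) - (d * rip X Y - rip Y Y)).
  by rewrite mulr_ge0// invr_ge0 ltW.
rewrite !(mulrBr, mulrDr, mulrDl, mul1r, mulVKf, mulKf) ?gt_eqF//.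
lra.
Qed.

Lemma rV_mul_adj p (a : 'rV[C]_p) : a *m a^t* = ((rip a a)%:C)%:M.
Proof.
have [h1 h2] : (a *m a^t*)^t* = a *m a^t* /\ rip a a = complex.Re (\tr (a *m a^t*)).
  by rewrite adjmxM adjmxK -rip_adj /rip adjmxK.
rewrite h2 trace_mx11; apply/matrixP => i j; rewrite !ord1 [RHS]mxE mulr1n.
move/matrixP/(_ 0 0): h1; rewrite !mxE; case: (\sum_j _) => x y /= [] /eqP.
by rewrite eq_sym -subr_eq0 opprK -mulr2n mulrn_eq0 /= => /eqP ->.
Qed.

(** Cauchy-Schwarz, from the nonnegative square of [|a|^2 u - a^* (a u)]. *)
Lemma rip_mul_rV_le p (a : 'rV[C]_p) (u : 'cV[C]_p) :
  rip (a *m u) (a *m u) <= rip a a * rip u u.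
Proof.
have [->|a0] := eqVneq a 0; first by rewrite mul0mx !rip0l mul0r.
have A0 : 0 < rip a a by rewrite rip_gt0.
have := rip_ge0 ((rip a a)%:C *: u - a^t* *m (a *m u)).
have cross : rip u (a^t* *m (a *m u)) = rip (a *m u) (a *m u).
  by rewrite [RHS]rip_mulmxl.
have sq : rip (a^t* *m (a *m u)) (a^t* *m (a *m u))
    = rip a a * rip (a *m u) (a *m u).
  by rewrite [LHS]rip_mulmxl adjmxK mulmxA rV_mul_adj mul_scalar_mx ripZr.
rewrite !(ripBl, ripBr, ripZl, ripZr) (ripC _ u) cross sq => h.
rewrite -subr_ge0 -(pmulr_rge0 _ A0); lra.
Qed.

Lemma rip_rows m p (X Y : 'M[C]_(m, p)) :
  rip X Y = \sum_i rip (row i X) (row i Y).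
Proof.
rewrite ripE; apply: eq_bigr => i _; rewrite ripE big_ord1.
by apply: eq_bigr => j _; rewrite !mxE.
Qed.

Lemma rip_mulmx_le m p (A : 'M[C]_(m, p)) (u : 'cV[C]_p) :
  rip (A *m u) (A *m u) <= rip A A * rip u u.
Proof.
rewrite rip_rows (rip_rows A) mulr_suml; apply: ler_sum => i _.
by rewrite row_mul rip_mul_rV_le.
Qed.

Lemma rip_diag_le m (d : 'rV[C]_m) (c : R) (u : 'cV[C]_m) :
  (forall i, complex.Re (d 0 i) ^+ 2 + complex.Im (d 0 i) ^+ 2 <= c) ->
  rip (diag_mx d *m u) (diag_mx d *m u) <= c * rip u u.
Proof.
move=> dc; rewrite !ripE mulr_sumr; apply: ler_sum => i _.
rewrite !big_ord1 mul_diag_mx mxE.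
have := dc i; case: (d 0 i) (u i 0) => [a b] [x y] /= h.
have : 0 <= (c - (a ^+ 2 + b ^+ 2)) * (x ^+ 2 + y ^+ 2).
  by rewrite mulr_ge0 ?subr_ge0 ?addr_ge0 ?sqr_ge0.
lra.
Qed.

Lemma rip_diag_quad_le m (d : 'rV[C]_m) (c : R) (v : 'cV[C]_m) :
  (forall i, complex.Im (d 0 i) = 0 /\ complex.Re (d 0 i) <= c) ->
  rip v (diag_mx d *m v) <= c * rip v v.
Proof.
move=> dc; rewrite !ripE mulr_sumr; apply: ler_sum => i _.
rewrite !big_ord1 mul_diag_mx mxE.
have := dc i; case: (d 0 i) (v i 0) => [a b] [x y] /= [-> h].
have : 0 <= (c - a) * (x ^+ 2 + y ^+ 2).
  by rewrite mulr_ge0 ?subr_ge0 ?addr_ge0 ?sqr_ge0.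
lra.
Qed.

Lemma hermitian_spectral m (A : 'M[C]_m) : A^t* = A ->
  exists (U : 'M[C]_m) (d : 'rV[R]_m),
    U *m U^t* = 1%:M /\ A = U^t* *m diag_mx (mxC d) *m U.
Proof.
move=> hA; have hermA : A \is hermsymmx by rewrite is_hermitianmxE expr0 scale1r hA.
have dr := mxOverP (hermitian_spectral_diag_real hermA).
have uP := spectral_unitarymx A.
exists (spectralmx A), (map_mx (@complex.Re R) (spectral_diag A)).
split; first exact/unitarymxP.
have -> : mxC (map_mx (@complex.Re R) (spectral_diag A)) = spectral_diag A.
  by apply/rowP => i; rewrite !mxE RRe_real.
by rewrite {1}(orthomx_spectralP (hermitian_normalmx hermA)) invmx_unitary.
Qed.

(** [eigenvalue] speaks of row vectors; the adjoint of a row eigenvector is a column eigenvector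
    because the Gram matrix is Hermitian and [c] is real. *)
Lemma eigenvalue_gram m p (G : 'M[C]_(m, p)) (c : R) :
  eigenvalue (G^t* *m G) c%:C ->
  exists2 x : 'cV[C]_p, x != 0 & rip (G *m x) (G *m x) = c * rip x x.
Proof.
move=> /eigenvalueP[v ve v0]; exists (v^t*).
  by apply: contraNneq v0 => v0; rewrite -(adjmxK v) v0 trmx0 map_mx0.
have /(congr1 (fun M => M^t*)) := ve.
rewrite adjmx_real adjmxM adjmxM adjmxK => e.
by rewrite rip_mulmxl mulmxA e ripZr.
Qed.

Lemma singular_value_le m p (G : 'M[C]_(m, p)) (s : R) :
  singular_value G s -> forall c, 0 <= c ->
  (forall u : 'cV[C]_p, rip (G *m u) (G *m u) <= c ^+ 2 * rip u u) -> s <= c.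
Proof.
move=> [s0 /eigenvalue_gram[x x0 e]] c c0 /(_ x); rewrite e.
by rewrite ler_pM2r ?rip_gt0// ler_sqr.
Qed.

Lemma sigma1_ge0 m p (G : 'M[C]_(m, p)) : 0 <= sigma1 G.
Proof.
(* [sup] is 0 by convention on an empty or unbounded set, so the bound holds before the singular
   values are known to be bounded. *)
have [[s Gs]|no] := pselect (exists s, singular_value G s); last first.
  rewrite /sigma1 (_ : [set _ | _] = set0) ?sup0//.
  by apply/seteqP; split => // s Gs; apply: no; exists s.
have [ub|nub] := pselect (has_ubound [set s : R | singular_value G s]).
  by apply: (le_trans Gs.1); rewrite /sigma1; apply: ub_le_sup.
by rewrite /sigma1 sup_out// => -[].
Qed.

(** In an orthonormal eigenbasis of [G^* G] the form is a sum of squares weighted by the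
    eigenvalues, each of which is the square of a singular value. *)
Lemma gain_sigma1 m p (G : 'M[C]_(m, p)) (u : 'cV[C]_p) :
  rip (G *m u) (G *m u) <= sigma1 G ^+ 2 * rip u u.
Proof.
set A := G^t* *m G.
have hA : A^t* = A by rewrite /A adjmxM adjmxK.
have [P [d [PP AE]]] := hermitian_spectral hA.
have PP' : P^t* *m P = 1%:M by exact: mulmx1C.
have eig i : eigenvalue A (d 0 i)%:C.
  apply/eigenvalueP; exists (row i P); last first.
    apply/eqP => P0; have /(congr1 (fun M => row i M)) := PP.
    rewrite row_mul P0 mul0mx => /rowP/(_ i).
    by rewrite !mxE eqxx => /eqP; rewrite eq_sym oner_eq0.
  rewrite AE -row_mul !mulmxA PP mul1mx.
  by apply/rowP => j; rewrite row_mul row_diag_mx -scalemxAl -rowE !mxE.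
have dle i : d 0 i <= sigma1 G ^+ 2.
  have [x x0 xe] := eigenvalue_gram (eig i).
  have d0 : 0 <= d 0 i.
    by rewrite -(pmulr_lge0 _ (_ : 0 < rip x x)) ?rip_gt0// -xe rip_ge0.
  rewrite -(sqr_sqrtr d0) ler_sqr ?nnegrE ?sqrtr_ge0 ?sigma1_ge0//.
  have sv : singular_value G (Num.sqrt (d 0 i)).
    by rewrite /singular_value sqrtr_ge0 (sqr_sqrtr d0).
  rewrite /sigma1; apply: ub_le_sup sv.
  (* A crude upper bound of the singular values, so that [sup] is a true supremum: the squared gain
     is at most [rip G G], hence at most the square of [1 + rip G G]. *)
  exists (1 + rip G G) => s Gs; apply: (singular_value_le Gs).
    by rewrite addr_ge0 ?rip_ge0.
  move=> v; apply: (le_trans (rip_mulmx_le _ _)).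
  rewrite ler_wpM2r ?rip_ge0//; have := rip_ge0 G; nra.
have -> : rip u u = rip (P *m u) (P *m u) by rewrite rip_mulmxl mulmxA PP' mul1mx.
rewrite rip_mulmxl mulmxA -/A {1}AE -!mulmxA; set v := P *m u.
have -> : rip u (P^t* *m (diag_mx (mxC d) *m v)) = rip v (diag_mx (mxC d) *m v).
  by rewrite ripC rip_mulmxl adjmxK ripC.
by apply: rip_diag_quad_le => i; rewrite mxE; split => //; exact: dle.
Qed.

(** From here on singular values enter only through this quadratic inequality, which compares
    directly with the forms defined by the LMI. *)
Lemma sigma1_leP m p (G : 'M[C]_(m, p)) (c : R) : 0 <= c ->
  (sigma1 G <= c) <->
  (forall u : 'cV[C]_p, rip (G *m u) (G *m u) <= c ^+ 2 * rip u u).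
Proof.
move=> c0; split => [Gc u|Gc].
  apply: (le_trans (gain_sigma1 _ _)); rewrite ler_wpM2r ?rip_ge0//.
  by rewrite ler_sqr ?nnegrE ?sigma1_ge0.
have [[s Gs]|no] := pselect (exists s, singular_value G s); last first.
  rewrite /sigma1 (_ : [set _ | _] = set0) ?sup0//.
  by apply/seteqP; split => // s Gs; apply: no; exists s.
by apply: ge_sup => [|t /singular_value_le]; [exists s|apply].
Qed.

Lemma Hinf_norm_ge0 m p (G : C -> 'M[C]_(m, p)) : (0 <= Hinf_norm G)%E.
Proof.
apply: (@le_trans _ _ (sigma1 (G (0 +i* 0)))%:E); first by rewrite lee_fin sigma1_ge0.
by apply: ereal_sup_ubound; exists 0.
Qed.

Lemma Hinf_norm_leP m p (G : C -> 'M[C]_(m, p)) (c : R) : 0 <= c ->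
  (Hinf_norm G <= c%:E)%E <->
  (forall (w : R) (u : 'cV[C]_p),
     rip (G (0 +i* w) *m u) (G (0 +i* w) *m u) <= c ^+ 2 * rip u u).
Proof.
move=> c0; split => [Gc w|Gc].
  apply/(sigma1_leP _ c0); rewrite -lee_fin; apply: (le_trans _ Gc).
  by apply: ereal_sup_ubound; exists w.
apply: ge_ereal_sup => _ [w _ <-]; rewrite lee_fin.
by apply/(sigma1_leP _ c0).
Qed.

End Gain.

(** * Continuity of matrix-valued functions *)

Section ContinuousMatrixFunctions.
Local Open Scope classical_set_scope.
Local Open Scope complex_scope.
Local Open Scope sesquilinear_scope.
Context {R : realType} {T : topologicalType}.
Local Notation C := R[i].

Lemma sum_continuous I (s : seq I) (F : I -> T -> R) :
  (forall i, continuous (F i)) -> continuous (fun x => \sum_(i <- s) F i x).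
Proof. by move=> Fc; apply: continuous_big => // x; exact: add_continuous. Qed.

Lemma fun_continuousD (f g : T -> R) :
  continuous f -> continuous g -> continuous (fun x => f x + g x).
Proof. by move=> fc gc x; apply: (cvgD (fc x) (gc x)). Qed.

Lemma fun_continuousM (f g : T -> R) :
  continuous f -> continuous g -> continuous (fun x => f x * g x).
Proof. by move=> fc gc x; apply: (cvgM (fc x) (gc x)). Qed.

Lemma fun_continuousN (f : T -> R) :
  continuous f -> continuous (fun x => - f x).
Proof. by move=> fc x; apply: (cvgN (fc x)). Qed.

(** Continuity is taken entry by entry on real and imaginary parts, so that only the topology of [R]
    is involved. *)
Definition mxcont m p (F : T -> 'M[C]_(m, p)) := forall i j,
  continuous (fun x => complex.Re (F x i j)) /\
  continuous (fun x => complex.Im (F x i j)).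

Lemma mxcont_cst m p (A : 'M[C]_(m, p)) : mxcont (fun=> A).
Proof. by move=> i j; split; exact: cst_continuous. Qed.

Lemma mxcontD m p (F G : T -> 'M[C]_(m, p)) :
  mxcont F -> mxcont G -> mxcont (fun x => F x + G x).
Proof.
move=> Fc Gc i j; have [[a b] [c d]] := (Fc i j, Gc i j); split.
  under eq_fun do rewrite mxE ReD.
  exact: fun_continuousD.
have E x : complex.Im ((F x + G x) i j) = complex.Im (F x i j) + complex.Im (G x i j).
  by rewrite mxE; case: (F x i j) (G x i j) => ? ? [].
under eq_fun do rewrite E.
exact: fun_continuousD.
Qed.

Lemma mxcont_adj m p (F : T -> 'M[C]_(m, p)) :
  mxcont F -> mxcont (fun x => (F x)^t*).
Proof.
move=> Fc i j; have [a b] := Fc j i; split.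
  rewrite (_ : (fun x => _) = fun x => complex.Re (F x j i)) => [//|].
  by apply/funext => x; rewrite !mxE; case: (F x j i).
rewrite (_ : (fun x => _) = fun x => - complex.Im (F x j i)).
  exact: fun_continuousN.
by apply/funext => x; rewrite !mxE; case: (F x j i).
Qed.

Lemma mxcontM m p q (F : T -> 'M[C]_(m, p)) (G : T -> 'M[C]_(p, q)) :
  mxcont F -> mxcont G -> mxcont (fun x => F x *m G x).
Proof.
move=> Fc Gc i j; split.
  rewrite (_ : (fun x => _) = fun x => \sum_k
     (complex.Re (F x i k) * complex.Re (G x k j) +
      - (complex.Im (F x i k) * complex.Im (G x k j)))).
    apply: sum_continuous => k; have [[a b] [c d]] := (Fc i k, Gc k j).
    by apply: fun_continuousD; last apply: fun_continuousN; exact: fun_continuousM.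
  apply/funext => x; rewrite mxE Re_sum; apply: eq_bigr => k _.
  by case: (F x i k) (G x k j) => ? ? [].
rewrite (_ : (fun x => _) = fun x => \sum_k
   (complex.Re (F x i k) * complex.Im (G x k j) +
    complex.Im (F x i k) * complex.Re (G x k j))).
  apply: sum_continuous => k; have [[a b] [c d]] := (Fc i k, Gc k j).
  by apply: fun_continuousD; exact: fun_continuousM.
have ImD (y z : C) : complex.Im (y + z) = complex.Im y + complex.Im z.
  by case: y z => ? ? [].
apply/funext => x; rewrite mxE (big_morph _ ImD (erefl : complex.Im (0 : C) = 0)).
apply: eq_bigr => k _.
by case: (F x i k) (G x k j) => ? ? [].
Qed.

Lemma rip_continuous m p (F G : T -> 'M[C]_(m, p)) :
  mxcont F -> mxcont G -> continuous (fun x => rip (F x) (G x)).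
Proof.
move=> Fc Gc; under eq_fun do rewrite ripE.
apply: sum_continuous => i; apply: sum_continuous => j.
have [[a b] [c d]] := (Fc i j, Gc i j).
by apply: fun_continuousD; exact: fun_continuousM.
Qed.

End ContinuousMatrixFunctions.

(** * Compactness and minima on the unit sphere *)

Section SphereMinimum.
Local Open Scope classical_set_scope.
Local Open Scope complex_scope.
Local Open Scope sesquilinear_scope.
Context {R : realType}.
Local Notation C := R[i].

Lemma closed_box_compact k (S : set 'rV[R]_k) (c : R) : closed S ->
  (forall v, S v -> forall i, `|v 0 i| <= c) -> compact S.
Proof.
move=> Scl Sc; apply: (subclosed_compact Scl
  (rV_compact (fun=> @segment_compact R (- c) c))) => v Sv i /=.
by rewrite in_itv /= -ler_norml; exact: Sc.
Qed.

(** Real coordinates on complex matrices, all real parts first and then all imaginary parts;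
    compactness is carried over from real row vectors. *)
Definition mx_of_rV m p (v : 'rV[R]_(m * p + m * p)) : 'M[C]_(m, p) :=
  \matrix_(i, j) (vec_mx (lsubmx v) i j +i* vec_mx (rsubmx v) i j).

Lemma mx_of_rV_surj m p (X : 'M[C]_(m, p)) : exists v, mx_of_rV v = X.
Proof.
exists (row_mx (mxvec (map_mx (@complex.Re _) X)) (mxvec (map_mx (@complex.Im _) X))).
apply/matrixP => i j; rewrite mxE row_mxKl row_mxKr !mxvecK !mxE.
by case: (X i j).
Qed.

Lemma mxcont_mx_of_rV m p : mxcont (@mx_of_rV m p).
Proof.
by move=> i j; split; under eq_fun do rewrite !mxE /=; exact: coord_continuous.
Qed.

Lemma mx_of_rV_le m p (v : 'rV[R]_(m * p + m * p)) k :
  v 0 k ^+ 2 <= rip (mx_of_rV v) (mx_of_rV v).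
Proof.
case: (splitP k) => k' kk'.
  case/mxvec_indexP: k' kk' => i j /= kk'.
  have -> : k = lshift _ (mxvec_index i j) by apply: val_inj.
  apply: le_trans (rip_entry _ i j); rewrite !mxE /= ler_wpDr ?sqr_ge0//.
case/mxvec_indexP: k' kk' => i j /= kk'.
have -> : k = rshift _ (mxvec_index i j) by apply: val_inj.
apply: le_trans (rip_entry _ i j); rewrite !mxE /= ler_wpDl ?sqr_ge0//.
Qed.

Lemma sphere_min m p (f : 'M[C]_(m, p) -> R) (X : 'M[C]_(m, p)) :
  rip X X = 1 -> continuous (f \o @mx_of_rV m p) ->
  exists2 Z, rip Z Z = 1 & forall Y, rip Y Y = 1 -> f Z <= f Y.
Proof.
move=> X1 fc; pose S := [set v | rip (@mx_of_rV m p v) (@mx_of_rV m p v) = 1].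
have ripc : continuous (fun v => rip (@mx_of_rV m p v) (@mx_of_rV m p v)).
  by apply: rip_continuous; exact: mxcont_mx_of_rV.
have Scl : closed S.
  apply: (@preimage_closed _ R (fun v => rip (@mx_of_rV m p v) (mx_of_rV v)) [set 1]).
    by move=> v _; exact: ripc.
  exact: (accessible_closed_set1 (hausdorff_accessible (@Rhausdorff R))).
have Sc : compact S.
  apply: (@closed_box_compact _ _ 1) => // v Sv i.
  by rewrite -ler_sqr ?nnegrE// real_normK ?num_real// expr1n -Sv mx_of_rV_le.
have S0 : S !=set0 by have [v vX] := mx_of_rV_surj X; exists v; rewrite /S /= vX.
have [v /set_mem Sv vmin] := compact_EVT_min S0 Sc (continuous_subspaceT fc).
exists (mx_of_rV v) => // Y Y1; have [u uY] := mx_of_rV_surj Y.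
by rewrite -uY; apply: vmin; rewrite inE /S /= uY.
Qed.

End SphereMinimum.

(** * A theorem of alternatives for Hermitian certificates *)

Section Alternative.
Local Open Scope classical_set_scope.
Local Open Scope complex_scope.
Local Open Scope sesquilinear_scope.
Context {R : realType}.
Local Notation C := R[i].

Lemma gramZ n p (c : R) (Z : 'M[C]_(n, p)) :
  (c%:C *: Z) *m (c%:C *: Z)^t* = (c ^+ 2)%:C *: (Z *m Z^t*).
Proof.
by rewrite adjmx_real -scalemxAl -scalemxAr scalerA expr2 [(c * c)%:C]rmorphM.
Qed.

Lemma ker_cV n p (Z : 'M[C]_(n, p)) : (n < p)%N ->
  exists2 w : 'cV[C]_p, w != 0 & Z *m w = 0.
Proof.
move=> np; have : kermx Z^T != 0.
  rewrite kermx_eq0 /row_free mxrank_tr; apply/negP => /eqP r.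
  by have := rank_leq_row Z; rewrite r leqNgt np.
move=> /rowV0Pn[v /sub_kermxP vZ v0]; exists v^T.
  by rewrite trmx_eq0.
by rewrite -[Z]trmxK -trmx_mul vZ trmx0.
Qed.

(** The expression is affine in [t]; being nonnegative on the half-line, it has a nonnegative
    slope. *)
Lemma first_order_ineq (m rho s K w : R) : 0 < w ->
  (forall t, 0 <= t -> 0 <= 2 * t * w * (s - rho * m) + w ^+ 2 * K) ->
  rho * m <= s.
Proof.
move=> w0 h; rewrite leNgt; apply/negP => lt.
have d0 : 0 < rho * m - s by rewrite subr_gt0.
(* If the slope were negative, this [t] would make the linear term [- 2 w^2 (|K| + 1)], which
   outweighs [w^2 K]. *)
have /h : 0 <= w * (`|K| + 1) / (rho * m - s).
  by rewrite divr_ge0 ?(ltW d0)// mulr_ge0 ?(ltW w0)// addr_ge0.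
have -> : 2 * (w * (`|K| + 1) / (rho * m - s)) * w * (s - rho * m)
    = - (2 * w ^+ 2 * (`|K| + 1)).
  by field; rewrite gt_eqF.
have w2 : 0 < w ^+ 2 by rewrite exprn_gt0.
have : 0 <= w ^+ 2 * (`|K| - K) by rewrite mulr_ge0 ?(ltW w2)// subr_ge0 ler_norm.
have : 0 <= w ^+ 2 * `|K| by rewrite mulr_ge0 ?(ltW w2).
lra.
Qed.

Context (n N : nat) (J F : 'M[C]_(n, N)) (Th : 'M[C]_N).

(** Up to the pairing [rip], [Y] is the adjoint of the map sending [P] to [F^* P J + J^* P F];
    [ripY] below is this duality on rank-one [W]. *)
Let Y (W : 'M[C]_N) := F *m W *m J^t* + J *m W *m F^t*.
Let obj (W : 'M[C]_N) := rip (Y W) (Y W) + rip (Th^t*) W ^+ 2.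

Let YD V W : Y (V + W) = Y V + Y W.
Proof. by rewrite /Y !(mulmxDl, mulmxDr) addrACA. Qed.

Let YZ (c : R) W : Y (c%:C *: W) = c%:C *: Y W.
Proof. by rewrite /Y -!(scalemxAr, scalemxAl) scalerDr. Qed.

Let YH (W : 'M[C]_N) : W^t* = W -> (Y W)^t* = Y W.
Proof. by move=> h; rewrite /Y adjmxD !adjmxM !adjmxK h addrC !mulmxA. Qed.

Let ripY P (z : 'cV[C]_N) : P^t* = P ->
  rip P (Y (z *m z^t*)) = 2 * rip (J *m z) (P *m (F *m z)).
Proof.
move=> h; rewrite /Y ripDr.
have E (A B : 'cV[C]_n) : rip P (A *m B^t*) = rip (P *m B) A.
  by rewrite ripC rip_mulmxr adjmxK ripC.
have EJ : F *m (z *m z^t*) *m J^t* = (F *m z) *m (J *m z)^t*.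
  by rewrite adjmxM !mulmxA.
have EF : J *m (z *m z^t*) *m F^t* = (J *m z) *m (F *m z)^t*.
  by rewrite adjmxM !mulmxA.
have EP : rip (P *m (J *m z)) (F *m z) = rip (J *m z) (P *m (F *m z)).
  by rewrite [LHS]rip_mulmxl h.
by rewrite EJ EF !E EP [X in _ + X]ripC mulr_natl mulr2n.
Qed.

(** Matrices [Z] of width [N.+1] have a nontrivial kernel, so any rank-one term [z z^*] can be added
    to the Gram matrix of the minimiser without changing the width. This makes the first-order
    condition available in every direction [z]. *)
Lemma hermitian_alternative :
  (exists (P : 'M[C]_n) (t : R), P^t* = P /\ forall z : 'cV[C]_N, z != 0 ->
     2 * rip (J *m z) (P *m (F *m z)) + t * rip z (Th *m z) < 0) \/
  (exists Z : 'M[C]_(N, N.+1), [/\ Z != 0,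
     F *m Z *m (J *m Z)^t* + J *m Z *m (F *m Z)^t* = 0 &
     rip Z (Th *m Z) = 0]).
Proof.
have [[z1 z10]|no] := pselect (exists z : 'cV[C]_N, z != 0); last first.
  left; exists 0, 0; split => [|z z0]; first by rewrite trmx0 map_mx0.
  by case: no; exists z.
pose f (Z : 'M[C]_(N, N.+1)) := obj (Z *m Z^t*).
have trE p (Z : 'M[C]_(N, p)) : rip Z Z = rip 1%:M (Z *m Z^t*).
  by rewrite [RHS]ripC rip_mulmxr adjmxK mul1mx.
have [X0 X00] : exists X : 'M[C]_(N, N.+1), X != 0.
  exists (z1 *m delta_mx 0 0); apply: contraNneq z10 => /matrixP e.
  apply/eqP/matrixP => i j; have := e i 0.
  by rewrite ord1 !mxE big_ord1 !mxE !eqxx mulr1.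
have norm1 (X : 'M[C]_(N, N.+1)) : X != 0 ->
    let c := (Num.sqrt (rip X X))^-1 in rip (c%:C *: X) (c%:C *: X) = 1.
  move=> X_0 c; have r0 : 0 < rip X X by rewrite rip_gt0.
  rewrite ripZl ripZr mulrA -expr2 exprVn sqr_sqrtr ?mulVf ?gt_eqF//.
  exact: ltW.
have fc : continuous (f \o @mx_of_rV R N N.+1).
  have dc := @mxcont_mx_of_rV R N N.+1.
  have dd : mxcont (fun v => mx_of_rV v *m (mx_of_rV v : 'M[C]_(N, N.+1))^t*).
    by apply: mxcontM => //; exact: mxcont_adj.
  have Yc : mxcont (fun v => Y (mx_of_rV v *m (mx_of_rV v : 'M[C]_(N, N.+1))^t*)).
    by apply: mxcontD; apply: mxcontM; try exact: mxcont_cst;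
      apply: mxcontM => //; exact: mxcont_cst.
  have tc : continuous (fun v => rip (Th^t*) (mx_of_rV v *m (mx_of_rV v : 'M[C]_(N, N.+1))^t*)).
    by apply: rip_continuous => //; exact: mxcont_cst.
  apply: fun_continuousD; first exact: rip_continuous.
  exact: fun_continuousM.
have [Z0 Z01 Z0min] := sphere_min (norm1 _ X00) fc.
have f0 : 0 <= f Z0 by rewrite addr_ge0 ?rip_ge0 ?sqr_ge0.
have [fz|fz] := eqVneq (f Z0) 0.
  right; exists Z0; move: fz => /eqP; rewrite /f /obj paddr_eq0 ?rip_ge0 ?sqr_ge0//.
  rewrite rip_eq0 sqrf_eq0 rip_gram => /andP[/eqP y0 /eqP q0]; split => //.
    by rewrite -rip_gt0 Z01.
  by rewrite -y0 /Y !adjmxM !mulmxA.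
left; set m := f Z0 in f0 fz Z0min; have m0 : 0 < m by rewrite lt_def fz.
(* [f] is homogeneous of degree 4, so the bound on the sphere extends to all [Z]. *)
have homog (Z : 'M[C]_(N, N.+1)) : m * rip Z Z ^+ 2 <= f Z.
  have [->|Z_0] := eqVneq Z 0.
    by rewrite rip0l expr0n mulr0 /f /obj addr_ge0 ?rip_ge0 ?sqr_ge0.
  have := Z0min _ (norm1 _ Z_0); rewrite /f gramZ exprVn (sqr_sqrtr (rip_ge0 Z)) /obj.
  rewrite (YZ _ (Z *m Z^t*)); set y := Y _; rewrite !ripZr ripZl.
  have r0 : 0 < rip Z Z by rewrite rip_gt0.
  rewrite -(ler_pM2r (exprn_gt0 2 r0)) => /le_trans; apply.
  by rewrite le_eqVlt; apply/orP; left; apply/eqP; field; rewrite gt_eqF.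
have [w w0 Zw] := ker_cV Z0 (ltnSn N).
set W0 := Z0 *m Z0^t*.
(* The multipliers are minus the two residuals at the minimiser. With them the form to be bounded is
   [- s], where [s] is half the derivative of [obj] at [W0] along [z z^*]. *)
exists (- Y W0), (- rip (Th^t*) W0); split.
  by rewrite adjmxN YH// /W0 adjmxM adjmxK.
move=> z z0; have om0 : 0 < rip w w by rewrite rip_gt0.
have rho0 : 0 < rip z z by rewrite rip_gt0.
have ww : w^t* *m w = ((rip w w)%:C)%:M.
  by have := rV_mul_adj (w^t*); rewrite adjmxK rip_adj.
set s := rip (Y W0) (Y (z *m z^t*)) + rip (Th^t*) W0 * rip z (Th *m z).
suff : rip z z * m <= s.
  have : 0 < rip z z * m by rewrite mulr_gt0.
  rewrite /s mulNmx ripNr ripY ?YH /W0 ?adjmxM ?adjmxK//; lra.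
apply: (first_order_ineq om0 (K := rip (Y (z *m z^t*)) (Y (z *m z^t*)) +
  rip z (Th *m z) ^+ 2 - m * rip z z ^+ 2)) => t t0.
(* Since [Z0 w = 0] the cross terms vanish and the Gram matrix of [Z] is [t W0 + |w|^2 z z^*]. *)
pose Z := (Num.sqrt t)%:C *: Z0 + z *m w^t*.
have ZZ : Z *m Z^t* = t%:C *: W0 + (rip w w)%:C *: (z *m z^t*).
  rewrite /Z adjmxD adjmx_real adjmxM adjmxK mulmxDl !mulmxDr.
  rewrite -!scalemxAl -!scalemxAr -/W0 scalerA -rmorphM -expr2 sqr_sqrtr//.
  rewrite mulmxA Zw mul0mx !scaler0 addr0.
  have -> : z *m w^t* *m Z0^t* = z *m (Z0 *m w)^t* by rewrite adjmxM mulmxA.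
  rewrite Zw trmx0 map_mx0 mulmx0 scaler0 add0r.
  by rewrite mulmxA -(mulmxA z) ww mul_mx_scalar -scalemxAl.
set y := Y (z *m z^t*) in s *; set y0 := Y W0 in s *.
have e1 : rip Z Z = t + rip w w * rip z z.
  by rewrite trE ZZ ripDr !ripZr -(trE _ z) -(trE _ Z0) Z01 mulr1.
have e2 : f Z = rip (t%:C *: y0 + (rip w w)%:C *: y) (t%:C *: y0 + (rip w w)%:C *: y)
    + (t * rip (Th^t*) W0 + rip w w * rip z (Th *m z)) ^+ 2.
  have eT : rip (Th^t*) (Z *m Z^t*) =
      t * rip (Th^t*) W0 + rip w w * rip z (Th *m z).
    by rewrite ZZ ripDr !ripZr (rip_gram Th z).
  have eY : Y (Z *m Z^t*) = t%:C *: y0 + (rip w w)%:C *: y.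
    by rewrite ZZ YD (YZ t W0) (YZ _ (z *m z^t*)).
  by rewrite /f /obj eT eY.
(* This cancels the terms in [t^2] of [homog Z], and what remains is affine in [t]. *)
have mE : m = rip y0 y0 + rip (Th^t*) W0 ^+ 2 by [].
have := homog Z; rewrite e1 e2 /s -subr_ge0 => /le_trans; apply.
clearbody y y0 m.
rewrite ripDl !ripZl !ripDr !ripZr (ripC y y0) mE.
rewrite le_eqVlt; apply/orP; left; apply/eqP; ring.
Qed.

End Alternative.

(** * Splitting into single frequencies *)

Section FrequencyDecomposition.
Local Open Scope classical_set_scope.
Local Open Scope complex_scope.
Local Open Scope sesquilinear_scope.
Context {R : realType}.
Local Notation C := R[i].

(** Gram-Schmidt is run on a matrix with first row [q^*] and zeros elsewhere; the rows after the
    first form an orthonormal basis of the complement of [q]. *)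
Lemma orthonormal_complement k (q : 'cV[C]_k.+1) : q != 0 ->
  exists V : 'M[C]_(k.+1, k),
    V *m V^t* + (rip q q)^-1%:C *: (q *m q^t*) = 1%:M.
Proof.
move=> q0; pose A : 'M[C]_k.+1 := (delta_mx 0 0 : 'cV_k.+1) *m q^t*.
have UU : schmidt A \is unitarymx by exact: schmidt_unitarymx.
have := row_schmidt_sub A 0.
rewrite (bigD1 0)//= big1 => [|i /andP[]]; last first.
  by rewrite leqn0 -val_eqE /= => ->.
rewrite addsmx0 genmxE.
have -> : row 0 A = q^t*.
  apply/rowP => j; rewrite !mxE (bigD1 0)//= big1 => [|i i0].
    by rewrite !mxE eqxx mul1r addr0.
  by rewrite ord1 in i0.
set U : 'M[C]_(1 + k) := schmidt A in UU *.
have -> : row 0 U = usubmx U.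
  apply/matrixP => i j; rewrite !mxE ord1; congr (U _ _); exact: val_inj.
case/submxP => D qE.
exists ((dsubmx U)^t*).
have e : (col_mx (usubmx U) (dsubmx U))^t* *m col_mx (usubmx U) (dsubmx U) = 1%:M.
  by rewrite vsubmxK; exact: mulmx1C (unitarymxP UU).
rewrite -e adj_col_mx mul_row_col.
rewrite adjmxK addrC; congr (_ + _).
have uu : usubmx U *m (usubmx U)^t* = 1%:M.
  have e' : col_mx (usubmx U) (dsubmx U) *m (col_mx (usubmx U) (dsubmx U))^t* = 1%:M.
    by rewrite vsubmxK; exact: unitarymxP UU.
  move: e'; rewrite adj_col_mx mul_col_row.
  by rewrite (@scalar_mx_block _ 1 k) => /eq_block_mx[].
have DD : D^t* *m D = ((rip q q)%:C)%:M.
  have := rV_mul_adj (q^t*); rewrite rip_adj qE adjmxM mulmxA -(mulmxA D) uu mulmx1.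
  move=> <-; apply/matrixP => i j; rewrite !ord1 !mxE !big_ord1 !mxE mulrC.
  by [].
rewrite -[q in q *m _]adjmxK qE adjmxM mulmxA -(mulmxA _ (D^t*)) DD mul_mx_scalar.
rewrite -scalemxAl scalerA -rmorphM mulVf ?scale1r//.
by rewrite gt_eqF// rip_gt0.
Qed.

(** If [G] is injective, a left inverse [L] gives [F = G T] with [T] skew-Hermitian, and the
    eigenvalues of [T] are purely imaginary. Otherwise a kernel vector of [G] is the case of
    infinite frequency. *)
Lemma skew_pair_eigen n k (F G : 'M[C]_(n, k.+1)) :
  F *m G^t* + G *m F^t* = 0 ->
  exists2 q : 'cV[C]_k.+1, q != 0 &
    G *m q = 0 \/ exists w : R, F *m q = (0 +i* w) *: (G *m q).
Proof.
move=> FG; have [[q q0 Gq]|inj] := pselect (exists2 q : 'cV[C]_k.+1, q != 0 & G *m q = 0).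
  by exists q => //; left.
have [L LG] : exists L, L *m G = 1%:M.
  apply/row_fullP; rewrite /row_full -mxrank_tr -/(row_free _) -kermx_eq0.
  apply/negPn/negP => /rowV0Pn[v /sub_kermxP vG v0]; apply: inj.
  exists v^T; first by rewrite trmx_eq0.
  by rewrite -[G]trmxK -trmx_mul vG trmx0.
pose T := - (F^t* *m L^t*).
have GL : G^t* *m L^t* = 1%:M by rewrite -adjmxM LG trmx1 map_mx1.
have FGT : F = G *m T.
  rewrite /T mulmxN mulmxA -[LHS]mulmx1 -GL mulmxA.
  by move/eqP: FG; rewrite addr_eq0 => /eqP ->; rewrite mulNmx.
have TT : T^t* = - T.
  apply/eqP; rewrite -addr_eq0; apply/eqP.
  have : L *m (F *m G^t* + G *m F^t*) *m L^t* = 0 by rewrite FG mulmx0 mul0mx.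
  rewrite {1 2}FGT adjmxM mulmxDr mulmxDl !mulmxA LG !mul1mx -!mulmxA GL mulmx1.
  by rewrite addrC mulmx1.
have [a /eigenvalueP[v va v0]] := eigenvalue_closed T^T (ltn0Sn k).
have Tq : T *m v^T = a *: v^T by rewrite -[T]trmxK -trmx_mul va linearZ.
have q0 : v^T != 0 by rewrite trmx_eq0.
exists v^T => //; right; exists (complex.Im a).
rewrite FGT -mulmxA Tq -scalemxAr; congr (_ *: _).
have aE : a = (complex.Re a)%:C + (0 +i* complex.Im a).
  by case: (a) => x y; apply/eqP; rewrite eq_complex /= addr0 add0r !eqxx.
suff a0 : complex.Re a = 0 by rewrite {1}aE a0 add0r.
have : rip v^T (T *m v^T) = complex.Re a * rip v^T v^T.
  by rewrite Tq {1}aE scalerDl ripDr ripZr rip_imag addr0.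
have : rip v^T (T *m v^T) = - rip v^T (T *m v^T).
  by rewrite {1}ripC rip_mulmxl TT mulNmx ripNr.
move/eqP; rewrite -subr_eq0 opprK -mulr2n mulrn_eq0 /= => /eqP -> /eqP.
by rewrite eq_sym mulf_eq0 rip_eq0 (negPf q0) orbF => /eqP.
Qed.

(** Induction on the number of columns. The column [Z q] given by [skew_pair_eigen] satisfies the
    balance equation by itself, so the equation passes to [Z V], which has one column fewer. *)
Lemma frequency_decomposition n N (J F : 'M[C]_(n, N)) (H : 'M[C]_N) :
  (forall z : 'cV[C]_N, J *m z = 0 -> z != 0 -> rip z (H *m z) < 0) ->
  (forall (z : 'cV[C]_N) (w : R), F *m z = (0 +i* w) *: (J *m z) -> z != 0 ->
     rip z (H *m z) < 0) ->
  forall k (Z : 'M[C]_(N, k)),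
    F *m Z *m (J *m Z)^t* + J *m Z *m (F *m Z)^t* = 0 -> Z != 0 ->
    rip Z (H *m Z) < 0.
Proof.
move=> Hinf Hfin; elim=> [|k IH] Z FZ Z0.
  by rewrite thinmx0 eqxx in Z0.
have [q q0 qP] := skew_pair_eigen FZ.
have [V VE] := orthonormal_complement q0.
set c := (rip q q)^-1 in VE; have c0 : 0 < c by rewrite invr_gt0 rip_gt0.
have ZZ : Z *m Z^t* = (Z *m V) *m (Z *m V)^t* + c%:C *: ((Z *m q) *m (Z *m q)^t*).
  have := congr1 (fun M => Z *m M *m Z^t*) VE; rewrite mulmx1 => <-.
  by rewrite mulmxDr mulmxDl -scalemxAr -scalemxAl (adjmxM Z V) (adjmxM Z q) !mulmxA.
have gE p (X : 'M[C]_(N, p)) : F *m X *m (J *m X)^t* + J *m X *m (F *m X)^t*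
    = F *m (X *m X^t*) *m J^t* + J *m (X *m X^t*) *m F^t*.
  by rewrite !adjmxM !mulmxA.
have zq : F *m (Z *m q) *m (J *m (Z *m q))^t* + J *m (Z *m q) *m (F *m (Z *m q))^t* = 0.
  case: qP => [|[w]]; rewrite -!(mulmxA _ Z q) => e; rewrite e.
    by rewrite trmx0 map_mx0 mulmx0 mul0mx addr0.
  rewrite adjmxZ -scalemxAr -scalemxAl -scalerDl.
  rewrite (_ : _ + _ = 0) ?scale0r//; apply/eqP.
  by rewrite eq_complex /= addr0 subrr !eqxx.
have ZV : F *m (Z *m V) *m (J *m (Z *m V))^t* + J *m (Z *m V) *m (F *m (Z *m V))^t* = 0.
  move: FZ zq; rewrite !gE ZZ !(mulmxDl, mulmxDr) -!scalemxAr -!scalemxAl.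
  rewrite addrACA -scalerDr => h1 h2; rewrite h2 scaler0 addr0 in h1.
  exact: h1.
have qle : Z *m q != 0 -> rip (Z *m q) (H *m (Z *m q)) < 0.
  by case: qP => [Jz|[w Fz]]; [apply: Hinf|apply: (Hfin _ w)]; rewrite !mulmxA.
rewrite -rip_gram ZZ ripDr ripZr !rip_gram.
have [ZV0|/(IH _ ZV) lt1] := eqVneq (Z *m V) 0; last first.
  have [->|/qle lt2] := eqVneq (Z *m q) 0; first by rewrite rip0l mulr0 addr0.
  by have := pmulr_rlt0 (rip (Z *m q) (H *m (Z *m q))) c0; rewrite lt2; lra.
rewrite ZV0 rip0l add0r pmulr_rlt0// qle//; apply: contraNneq Z0 => Zq.
by rewrite -[Z]mulmx1 -VE mulmxDr -scalemxAr !mulmxA ZV0 Zq !mul0mx scaler0 addr0.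
Qed.

End FrequencyDecomposition.

(** * Resolvent of a stable diagonal matrix on the imaginary axis *)

Section BoundedReal.
Local Open Scope classical_set_scope.
Local Open Scope complex_scope.
Local Open Scope sesquilinear_scope.
Context {R : realType}.
Local Notation C := R[i].

Lemma rip_diag_gt0 n (d : 'rV[C]_n) (v : 'cV[C]_n) :
  (forall i, 0 < complex.Re (d 0 i)) -> v != 0 -> 0 < rip v (diag_mx d *m v).
Proof.
move=> d0; rewrite -rip_gt0 => v0; rewrite lt_def.
have E : rip v (diag_mx d *m v) = \sum_i
    complex.Re (d 0 i) * (complex.Re (v i 0) ^+ 2 + complex.Im (v i 0) ^+ 2).
  rewrite ripE; apply: eq_bigr => i _; rewrite big_ord1 mul_diag_mx !mxE.
  by case: (d 0 i) (v i 0) => [a b] [x y] /=; ring.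
have ge0 i : 0 <= complex.Re (d 0 i) *
    (complex.Re (v i 0) ^+ 2 + complex.Im (v i 0) ^+ 2).
  by rewrite mulr_ge0 ?addr_ge0 ?sqr_ge0// ltW.
rewrite E sumr_ge0// andbT psumr_eq0//; apply: contraTN v0 => /allP v0.
rewrite -leNgt ripE le_eqVlt big1 ?eqxx// => i _; rewrite big_ord1.
have /= := v0 i (mem_index_enum i); rewrite mulf_eq0 gt_eqF//=.
by rewrite -!expr2 => /eqP.
Qed.

Lemma hermitian_posdef n (P : 'M[C]_n) : P^t* = P ->
  (forall (x : 'cV[C]_n) (c : R), x != 0 -> P *m x = c%:C *: x -> 0 < c) ->
  posdef P.
Proof.
move=> hP Ppos; apply/posdefP; split=> // x x0.
have [U [d [UU UP]]] := hermitian_spectral hP.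
have UU' : U^t* *m U = 1%:M by exact: mulmx1C.
have d0 i : 0 < d 0 i.
  apply: (Ppos (U^t* *m delta_mx i 0)).
    apply/eqP => /(congr1 (mulmx U)); rewrite mulmxA UU mul1mx mulmx0.
    by move/matrixP/(_ i 0); rewrite !mxE !eqxx => /eqP; rewrite oner_eq0.
  rewrite UP -!mulmxA (mulmxA U) UU mul1mx scalemxAr; congr (_ *m _).
  apply/matrixP => j k; rewrite mul_diag_mx !mxE.
  by case: eqVneq => [->|] //=; rewrite !mulr0.
rewrite UP -!mulmxA ripC rip_mulmxl adjmxK ripC.
have : U *m x != 0.
  by apply: contraNneq x0 => Ux; rewrite -[x]mul1mx -UU' -mulmxA Ux mulmx0.
by move=> Ux0; apply: rip_diag_gt0 => // i; rewrite mxE; exact: d0.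
Qed.

Definition resolvent n (lam : 'rV[C]_n) (w : R) : 'M[C]_n :=
  diag_mx (\row_i ((0 +i* w) - lam 0 i)^-1).

Context (n : nat) (lam : 'rV[C]_n).
Context (lam0 : forall i, complex.Re (lam 0 i) < 0).

Lemma imag_sub_neq0 w i : (0 +i* w) - lam 0 i != 0.
Proof.
have := lam0 i; case: (lam 0 i) => a b /= a0.
by rewrite eq_complex /= sub0r oppr_eq0 lt_eqF.
Qed.

(** The resolvent gives the state amplitude under harmonic forcing [z] at frequency [w]. *)
Lemma resolventP w (x z : 'cV[C]_n) :
  (0 +i* w) *: x = diag_mx lam *m x + z <-> x = resolvent lam w *m z.
Proof.
rewrite /resolvent mul_diag_mx; split.
  move/matrixP => e; apply/matrixP => i j; have := e i j.
  rewrite mul_diag_mx !mxE => h.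
  have -> : z i j = ((0 +i* w) - lam 0 i) * x i j by rewrite mulrBl h addrAC subrr add0r.
  by rewrite mulKf// imag_sub_neq0.
move=> ->; apply/matrixP => i j; rewrite mul_diag_mx !mxE.
have := mulfV (imag_sub_neq0 w i); set a := _ ^-1.
by move=> e; apply/eqP; rewrite addrC -subr_eq -mulrBl mulrA e mul1r.
Qed.

Lemma normsqV (z : C) : z != 0 ->
  complex.Re z^-1 ^+ 2 + complex.Im z^-1 ^+ 2 =
  (complex.Re z ^+ 2 + complex.Im z ^+ 2)^-1.
Proof.
case: z => a b; rewrite eq_complex /= => ab.
have : a ^+ 2 + b ^+ 2 != 0 by rewrite paddr_eq0 ?sqr_ge0// !sqrf_eq0.
by move=> h; field.
Qed.

Lemma resolvent_bound : exists2 K, 0 <= K &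
  forall w (z : 'cV[C]_n),
    rip (resolvent lam w *m z) (resolvent lam w *m z) <= K * rip z z.
Proof.
(* The distance from [i w] to a pole is at least the absolute real part of the pole; the sum
   dominates the largest of these inverse squares. *)
exists (\sum_i (complex.Re (lam 0 i) ^+ 2)^-1) => [|w z].
  by apply: sumr_ge0 => i _; rewrite invr_ge0 sqr_ge0.
apply: rip_diag_le => i; rewrite mxE (normsqV (imag_sub_neq0 w i)).
rewrite (bigD1 i)//= -[leLHS]addr0 lerD//; last first.
  by apply: sumr_ge0 => j _; rewrite invr_ge0 sqr_ge0.
have := lam0 i; case: (lam 0 i) => a b /= a0.
have a2 : 0 < a ^+ 2 by rewrite exprn_even_gt0//= lt_eqF.
rewrite lef_pV2 ?posrE ?sub0r ?sqrrN ?lerDl ?sqr_ge0//.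
by rewrite ltr_wpDr ?sqr_ge0.
Qed.

Lemma resolvent_small e : 0 < e -> exists w, forall z : 'cV[C]_n,
  rip (resolvent lam w *m z) (resolvent lam w *m z) <= e * rip z z.
Proof.
(* This [w] exceeds every [Im lambda_i] by at least [1 + 1/e], whose square exceeds [1/e]. *)
move=> e0; pose w := \sum_i `|complex.Im (lam 0 i)| + 1 + e^-1.
exists w => z; apply: rip_diag_le => i; rewrite mxE (normsqV (imag_sub_neq0 w i)).
have : 1 + e^-1 <= w - complex.Im (lam 0 i).
  rewrite /w (bigD1 i)//=.
  have : 0 <= \sum_(j < n | j != i) `|complex.Im (lam 0 j)| by exact: sumr_ge0.
  have := ler_norm (complex.Im (lam 0 i)); lra.
have ei : 0 < e^-1 by rewrite invr_gt0.
case: (lam 0 i) => a b /= le; rewrite -[leRHS]invrK lef_pV2 ?posrE//; last first.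
  by rewrite ltr_wpDl ?sqr_ge0// exprn_gt0//; lra.
have := sqr_ge0 (0 - a); nra.
Qed.

(** [D] is the value of the transfer function at infinity: at a large frequency the dynamic part is
    as small as desired. *)
Lemma feedthrough_gain m p (B : 'M[C]_(n, m)) (Cm : 'M[C]_(p, n)) (D : 'M[C]_(p, m))
    (h : R) (u : 'cV[C]_m) :
  (forall w, rip ((Cm *m resolvent lam w *m B + D) *m u)
     ((Cm *m resolvent lam w *m B + D) *m u) <= h ^+ 2 * rip u u) ->
  rip (D *m u) (D *m u) <= h ^+ 2 * rip u u.
Proof.
move=> hg; apply/ler_addgt0Pr => e e0.
pose a := h ^+ 2 * rip u u; have a0 : 0 <= a by rewrite mulr_ge0 ?sqr_ge0 ?rip_ge0.
pose b := rip Cm Cm * rip (B *m u) (B *m u).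
have b0 : 0 <= b by rewrite mulr_ge0 ?rip_ge0.
(* Half of [e] pays for the factor [1 + d] on the full response, the other half for [1 + 1/d] times
   the dynamic part; [a + 1] and [b + 1] keep the divisors positive. *)
pose d := e / (2 * (a + 1)).
have d0 : 0 < d by rewrite divr_gt0// mulr_gt0// ltr_wpDl.
have d1 : 0 < 1 + d^-1 by rewrite addr_gt0// invr_gt0.
have [w ws] := @resolvent_small (e / (2 * (b + 1) * (1 + d^-1)))
  (ltac:(by rewrite divr_gt0// mulr_gt0// mulr_gt0// ltr_wpDl)).
set X := resolvent lam w *m (B *m u).
have DE : D *m u = (Cm *m resolvent lam w *m B + D) *m u + - (Cm *m X).
  by rewrite mulmxDl /X !mulmxA addrAC subrr add0r.
have CX : rip (Cm *m X) (Cm *m X) <= e / (2 * (b + 1) * (1 + d^-1)) * b.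
  apply: (le_trans (rip_mulmx_le _ _)); rewrite /b mulrCA.
  by rewrite ler_wpM2l ?rip_ge0// ws.
rewrite DE; apply: (le_trans (rip_add_le _ _ d0)).
rewrite ripNl ripNr opprK.
have s1 : (1 + d) * rip ((Cm *m resolvent lam w *m B + D) *m u)
    ((Cm *m resolvent lam w *m B + D) *m u) <= a + e / 2.
  apply: (@le_trans _ _ ((1 + d) * a)).
    by rewrite ler_pM2l ?addr_gt0//; exact: hg.
  rewrite mulrDl mul1r lerD2l.
  have -> : e / 2 = d * (a + 1) by rewrite /d; field; rewrite gt_eqF ?ltr_wpDl.
  by rewrite ler_pM2l// lerDl.
have s2 : (1 + d^-1) * rip (Cm *m X) (Cm *m X) <= e / 2.
  apply: (@le_trans _ _ ((1 + d^-1) * (e / (2 * (b + 1) * (1 + d^-1)) * b))).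
    by rewrite ler_pM2l.
  have -> : (1 + d^-1) * (e / (2 * (b + 1) * (1 + d^-1)) * b) = e / 2 * (b / (b + 1)).
    move: (1 + d^-1) d1 => k k0; field; rewrite !gt_eqF ?ltr_wpDl//.
  have bb : b / (b + 1) <= 1 by rewrite ler_pdivrMr ?ltr_wpDl// mul1r lerDl.
  by rewrite ler_piMr// divr_ge0// ltW.
rewrite -/a; lra.
Qed.

End BoundedReal.

(** * The strict bounded real lemma *)

Section BoundedRealLemma.
Local Open Scope classical_set_scope.
Local Open Scope complex_scope.
Local Open Scope sesquilinear_scope.
Context {R : realType} (n : nat) (lam : 'rV[R[i]]_n).
Context (lam0 : forall i, complex.Re (lam 0 i) < 0).
Local Notation C := R[i].

Lemma bounded_real_mx_adj m p (A : 'M[C]_n) (B : 'M[C]_(n, m)) (K : 'M[C]_(p, n))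
    (D : 'M[C]_(p, m)) g (P : 'M[C]_n) : P^t* = P ->
  (bounded_real_mx A B K D g P)^t* = bounded_real_mx A B K D g P.
Proof.
move=> hP; have sc k : ((((- g)%:C)%:M : 'M[C]_k)^t*) = ((- g)%:C)%:M.
  by rewrite tr_scalar_mx map_scalar_mx; congr (_%:M); exact: conjc_real.
rewrite /bounded_real_mx !tr_block_mx !map_block_mx !sc tr_col_mx map_row_mx.
rewrite tr_row_mx map_col_mx !adjmxK; congr (block_mx (block_mx _ _ _ _) _ _ _).
by rewrite adjmxD !adjmxM adjmxK hP addrC.
Qed.

Lemma bounded_real_mx_form m p (A : 'M[C]_n) (B : 'M[C]_(n, m)) (K : 'M[C]_(p, n))
    (D : 'M[C]_(p, m)) g (P : 'M[C]_n) (x : 'cV[C]_n) (u : 'cV[C]_m) (y : 'cV[C]_p) :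
  P^t* = P ->
  let z := col_mx (col_mx x u) y in
  rip z (bounded_real_mx A B K D g P *m z) =
    2 * rip x (P *m (A *m x + B *m u)) + 2 * rip y (K *m x + D *m u)
    - g * rip u u - g * rip y y.
Proof.
move=> hP z; rewrite /z /bounded_real_mx mul_block_col mul_block_col mul_col_mx mul_row_col.
rewrite add_col_mx !rip_col_mx !mul_scalar_mx !ripDr !ripZr mulmxDl ripDr.
have adj q r (M : 'M[C]_(q, r)) (v : 'cV[C]_r) (v' : 'cV[C]_q) : rip v (M^t* *m v') = rip (M *m v) v'.
  by rewrite [RHS]rip_mulmxl.
have hPadj (v v' : 'cV[C]_n) : rip v (P *m v') = rip (P *m v) v' by rewrite -{1}hP adj.
rewrite -(mulmxA (A^t*)) !adj -!mulmxA (hPadj (A *m x)) -(hPadj (B *m u) x).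
rewrite (ripC (P *m (A *m x)) x) (ripC (B *m u)) -(hPadj x) mulmxDr ripDr.
rewrite (ripC (K *m x)) (ripC (D *m u)); ring.
Qed.

(** Schur complement of the block [- g I]: for fixed [x] and [u] the form is largest at
    [y = g^-1 (K x + D u)], and completing the square there leaves the dissipation inequality. *)
Lemma negdef_bounded_realP m p (A : 'M[C]_n) (B : 'M[C]_(n, m)) (K : 'M[C]_(p, n))
    (D : 'M[C]_(p, m)) g (P : 'M[C]_n) : 0 < g -> P^t* = P ->
  negdef (bounded_real_mx A B K D g P) <->
  forall (x : 'cV[C]_n) (u : 'cV[C]_m), (x != 0) || (u != 0) ->
    2 * rip x (P *m (A *m x + B *m u))
    + g^-1 * rip (K *m x + D *m u) (K *m x + D *m u) - g * rip u u < 0.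
Proof.
move=> g0 hP; split.
  move=> /posdefP[_ neg] x u xu; set y := K *m x + D *m u.
  have /neg : col_mx (col_mx x u) (g^-1%:C *: y) != 0.
    apply: contraTN xu; rewrite !col_mx_eq0 => /andP[/andP[-> ->]] _ //.
  rewrite mulNmx ripNr oppr_gt0 bounded_real_mx_form// -/y !ripZl ripZr.
  by rewrite (mulrA g) mulfV ?gt_eqF// mul1r; lra.
move=> neg; apply/posdefP; split; first by rewrite adjmxN bounded_real_mx_adj.
move=> z; rewrite -[z]vsubmxK -[usubmx z]vsubmxK.
move: (usubmx (usubmx z)) (dsubmx (usubmx z)) (dsubmx z) => x u y z0.
rewrite mulNmx ripNr oppr_gt0 bounded_real_mx_form//.
set v := K *m x + D *m u.
have sq : 0 <= g * rip (y - g^-1%:C *: v) (y - g^-1%:C *: v).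
  by rewrite mulr_ge0 ?rip_ge0// ltW.
have sqE : g * rip (y - g^-1%:C *: v) (y - g^-1%:C *: v) =
    g * rip y y - 2 * rip y v + g^-1 * rip v v.
  rewrite ripBl !ripBr !ripZl !ripZr (ripC v y); field; exact: lt0r_neq0.
have [|xu] := boolP ((x != 0) || (u != 0)).
  by move=> /neg; rewrite -/v; lra.
move: xu; rewrite negb_or !negbK => /andP[/eqP x0 /eqP u0].
move: z0; rewrite /v x0 u0 !col_mx_eq0 !eqxx /= => y0.
rewrite !mulmx0 addr0 ?rip0l ?rip0r; have : 0 < g * rip y y.
  by rewrite mulr_gt0 ?rip_gt0.
lra.
Qed.

Lemma bounded_real_gain m p (B : 'M[C]_(n, m)) (K : 'M[C]_(p, n))
    (D : 'M[C]_(p, m)) g (P : 'M[C]_n) : 0 < g -> P^t* = P ->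
  negdef (bounded_real_mx (diag_mx lam) B K D g P) ->
  forall w (u : 'cV[C]_m),
    rip ((K *m resolvent lam w *m B + D) *m u)
        ((K *m resolvent lam w *m B + D) *m u) <= g ^+ 2 * rip u u.
Proof.
move=> g0 hP negM w u; set y := _ *m u.
have neg := (negdef_bounded_realP (diag_mx lam) B K D g0 hP).1 negM.
have [u0|u0] := eqVneq u 0; first by rewrite /y u0 mulmx0 rip0l rip0r mulr0.
pose x := resolvent lam w *m (B *m u).
have xE : diag_mx lam *m x + B *m u = (0 +i* w) *: x by apply/esym/(resolventP lam0).
have := neg x u; rewrite u0 orbT xE -scalemxAr => /(_ isT).
(* At the harmonic state the stored energy is constant: [x^* P x] is real, so multiplying it by
   [i w] leaves no real part. *)
have -> : rip x ((0 +i* w) *: (P *m x)) = 0.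
  have [U [d [_ ->]]] := hermitian_spectral hP.
  rewrite -!mulmxA scalemxAr ripC rip_mulmxl adjmxK ripC.
  move: (U *m x) => v; rewrite ripE big1// => i _; rewrite big1// => j _.
  by rewrite mxE mul_diag_mx !mxE; case: (v i j) => a b /=; ring.
have yE : K *m x + D *m u = y by rewrite /y mulmxDl /x !mulmxA.
rewrite yE mulr0 add0r subr_lt0 ltr_pdivrMl// => /ltW.
by rewrite mulrA -expr2.
Qed.

Lemma rip_diag_lt0 (x : 'cV[C]_n) : x != 0 -> rip x (diag_mx lam *m x) < 0.
Proof.
move=> x0; rewrite -oppr_gt0 -ripNr -mulNmx -linearN /=.
apply: rip_diag_gt0 => // i; rewrite mxE; have := lam0 i.
by case: (lam 0 i) => a b /=; rewrite oppr_gt0.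
Qed.

Lemma strict_dissipation m p (B : 'M[C]_(n, m)) (K : 'M[C]_(p, n))
    (D : 'M[C]_(p, m)) h g : (0 < m)%N -> 0 <= h -> h < g ->
  (forall w (u : 'cV[C]_m),
    rip ((K *m resolvent lam w *m B + D) *m u)
        ((K *m resolvent lam w *m B + D) *m u) <= h ^+ 2 * rip u u) ->
  exists2 P : 'M[C]_n, P^t* = P &
  forall (x : 'cV[C]_n) (u : 'cV[C]_m), (x != 0) || (u != 0) ->
    2 * rip x (P *m (diag_mx lam *m x + B *m u))
    + g^-1 * rip (K *m x + D *m u) (K *m x + D *m u) - g * rip u u < 0.
Proof.
move=> m0 h0 hg gain; have g0 : 0 < g by exact: le_lt_trans hg.
have hg2 : h ^+ 2 < g ^+ 2 by rewrite ltr_sqr ?nnegrE// ltW.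
have low (y : 'cV[C]_p) (u : 'cV[C]_m) : u != 0 ->
    rip y y <= h ^+ 2 * rip u u -> rip y y - g ^+ 2 * rip u u < 0.
  rewrite -rip_gt0 => u0 yu; rewrite subr_lt0; apply: (le_lt_trans yu).
  by rewrite ltr_pM2r.
(* On [z = (x, u)], [J] reads the state, [F] its derivative, [E] the input and [Q] the output; [Th]
   is the supply [|output|^2 - g^2 |input|^2]. *)
pose J : 'M[C]_(n, n + m) := row_mx 1%:M 0.
pose F : 'M[C]_(n, n + m) := row_mx (diag_mx lam) B.
pose E : 'M[C]_(m, n + m) := row_mx 0 1%:M.
pose Q : 'M[C]_(p, n + m) := row_mx K D.
pose Th := Q^t* *m Q - (g ^+ 2)%:C *: (E^t* *m E).
have Jz x u : J *m col_mx x u = x by rewrite mul_row_col mul1mx mul0mx addr0.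
have Ez x u : E *m col_mx x u = u by rewrite mul_row_col mul1mx mul0mx add0r.
have Fz (x : 'cV[C]_n) u : F *m col_mx x u = diag_mx lam *m x + B *m u.
  by rewrite mul_row_col.
have Qz (x : 'cV[C]_n) u : Q *m col_mx x u = K *m x + D *m u by rewrite mul_row_col.
have Thz (x : 'cV[C]_n) u : rip (col_mx x u) (Th *m col_mx x u) =
    rip (K *m x + D *m u) (K *m x + D *m u) - g ^+ 2 * rip u u.
  rewrite /Th mulmxBl ripBr -scalemxAl ripZr -!mulmxA Qz Ez.
  by rewrite -!(ripC (_ *m _)) !rip_mulmxl !adjmxK Qz Ez.
have [[P [t [hP neg]]]|[Z [Z0 FZ ThZ]]] := hermitian_alternative J F Th; last first.
  suff : rip Z (Th *m Z) < 0 by rewrite ThZ ltxx.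
  (* With [J z = 0] the state is zero and only [D] acts; with [F z = i w J z] the output is the
     transfer function applied to [u]. In both cases [z != 0] forces [u != 0], so the gap between
     [h] and [g] makes the form negative. *)
  apply: frequency_decomposition FZ Z0 => [z|z w]; rewrite -[z]vsubmxK;
    move: (usubmx z) (dsubmx z) => x u; rewrite Jz.
    move=> -> z0; rewrite Thz mulmx0 add0r; apply: low; last exact: (feedthrough_gain lam0).
    by apply: contraNneq z0 => ->; rewrite col_mx0.
  rewrite Fz => /esym/(resolventP lam0) xE z0; rewrite Thz.
  have -> : K *m x + D *m u = (K *m resolvent lam w *m B + D) *m u.
    by rewrite xE mulmxDl !mulmxA.
  apply: low => //; apply: contraNneq z0 => u0.
  by rewrite xE u0 !mulmx0 col_mx0.
(* At zero state and a nonzero input only the [t] term survives, and its factor is negative because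
   the gain of [D] is below [g]. *)
have t0 : 0 < t.
  pose u1 : 'cV[C]_m := delta_mx (Ordinal m0) 0.
  have u10 : u1 != 0.
    by apply/eqP => /matrixP/(_ (Ordinal m0) 0)/eqP; rewrite !mxE !eqxx oner_eq0.
  have := neg (col_mx 0 u1); rewrite col_mx_eq0 (negPf u10) andbF => /(_ isT).
  rewrite Jz rip0l mulr0 add0r Thz mulmx0 add0r nmulr_llt0//.
  by apply: low => //; exact: (feedthrough_gain lam0).
have tg : 0 < t * g by rewrite mulr_gt0.
(* Dividing by [t g] turns the weights [t] and [t g^2] into [g^-1] and [g]. *)
exists ((t * g)^-1%:C *: P) => [|x u xu]; first by rewrite adjmx_real hP.
have := neg (col_mx x u); rewrite col_mx_eq0 negb_and xu => /(_ isT).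
rewrite Jz Fz Thz -scalemxAl ripZr => lt.
rewrite -(pmulr_rlt0 _ tg); apply: le_lt_trans lt; rewrite le_eqVlt.
by apply/orP; left; apply/eqP; field; rewrite !gt_eqF.
Qed.

Lemma bounded_real_lemma m p (B : 'M[C]_(n, m)) (K : 'M[C]_(p, n))
    (D : 'M[C]_(p, m)) h g : 0 <= h -> h < g ->
  (forall w (u : 'cV[C]_m),
    rip ((K *m resolvent lam w *m B + D) *m u)
        ((K *m resolvent lam w *m B + D) *m u) <= h ^+ 2 * rip u u) ->
  exists P : 'M[C]_n, posdef P /\ negdef (bounded_real_mx (diag_mx lam) B K D g P).
Proof.
move=> h0 hg gain; have g0 : 0 < g by exact: le_lt_trans hg.
(* A zero input channel is appended: [strict_dissipation] needs an input. *)
have [||P hP neg'] := @strict_dissipation (m + 1) p (row_mx B 0) K (row_mx D 0) h g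
    _ h0 hg.
- by rewrite addn1.
- move=> w u; rewrite mul_mx_row add_row_mx mulmx0 addr0 -[u]vsubmxK mul_row_col.
  rewrite mul0mx addr0; apply: (le_trans (gain _ _)); rewrite rip_col_mx.
  by rewrite ler_wpM2l ?sqr_ge0// lerDl rip_ge0.
have neg x (u : 'cV[C]_m) : (x != 0) || (u != 0) ->
    2 * rip x (P *m (diag_mx lam *m x + B *m u))
    + g^-1 * rip (K *m x + D *m u) (K *m x + D *m u) - g * rip u u < 0.
  move=> xu; have := neg' x (col_mx u 0).
  rewrite col_mx_eq0 eqxx andbT => /(_ xu).
  by rewrite !mul_row_col !mulmx0 !addr0 rip_col_mx rip0r addr0.
exists P; split; last exact/(negdef_bounded_realP _ _ _ _ g0 hP).
(* On an eigenvector of [P] the inequality with [u = 0] makes [c] times the form of [diag_mx lam]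
   negative; that form is negative by stability, so [c > 0]. *)
apply: hermitian_posdef => // x c x0 Px.
have := neg x 0; rewrite x0 => /(_ isT); rewrite !mulmx0 !addr0 rip0r mulr0 subr0.
have -> : rip x (P *m (diag_mx lam *m x)) = c * rip x (diag_mx lam *m x).
  by rewrite ripC -{1}hP -[LHS]ripC -rip_mulmxl Px ripZl.
have := rip_diag_lt0 x0; have := rip_ge0 (K *m x).
have : 0 < g^-1 by rewrite invr_gt0.
move: (rip x _) (rip (K *m x) _) (g^-1) => a b e e0 b0 a0 lt.
rewrite -(nmulr_rlt0 _ a0); have := mulr_ge0 (ltW e0) b0; lra.
Qed.

End BoundedRealLemma.

(** * The truncation error in diagonal form *)

Section ErrorModel.
Local Open Scope classical_set_scope.
Local Open Scope complex_scope.
Local Open Scope sesquilinear_scope.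
Context {R : realType} (n nu ny : nat).
Context (A : 'M[R]_n) (B : 'M[R]_(n, nu)) (C : 'M[R]_(ny, n)) (D : 'M[R]_(ny, nu)).
Context (X : 'M[R[i]]_n) (lam : 'rV[R[i]]_n).
Context (Hstable : stable (mxC A)) (HX : X \in unitmx)
  (HAX : mxC A *m X = X *m diag_mx lam).

Let Bd := invmx X *m mxC B.
Let Cd := mxC C *m X.

(** The rows of [X^-1] are left eigenvectors of [A], which is what [eigenvalue] asks for. *)
Lemma pole_Re_lt0 i : complex.Re (lam 0 i) < 0.
Proof.
apply: Hstable; apply/eigenvalueP; exists (row i (invmx X)); last first.
  apply/eqP => X0; have /(congr1 (row i)) := mulVmx HX.
  rewrite row_mul X0 mul0mx => /rowP/(_ i).
  by rewrite !mxE eqxx => /eqP; rewrite eq_sym oner_eq0.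
have VA : invmx X *m mxC A = diag_mx lam *m invmx X.
  by rewrite -[LHS]mulmx1 -(mulmxV HX) mulmxA -(mulmxA _ _ X) HAX !mulmxA mulVmx ?mul1mx.
by rewrite -row_mul VA row_mul row_diag_mx -scalemxAl -rowE.
Qed.

Definition error_output (alpha : 'cV[R]_n) : 'M[R[i]]_(ny, n) :=
  Cd *m (1%:M - diag_mx (mxC alpha)^T).

(** The similarity [X] diagonalises the resolvent of [A], and the residue sum is the same diagonal
    resolvent weighted by [alpha]. On the imaginary axis stability keeps [s] away from the poles. *)
Lemma error_transfer (alpha : 'cV[R]_n) (Da : 'M[R]_(ny, nu)) w :
  transfer (mxC A) (mxC B) (mxC C) (mxC D) (0 +i* w)
    - modal_truncation lam (residue Bd Cd) alpha Da (0 +i* w) =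
  error_output alpha *m resolvent lam w *m Bd + mxC (D - Da).
Proof.
set s := 0 +i* w.
have inv : invmx (s%:M - mxC A) = X *m resolvent lam w *m invmx X.
  have e : (s%:M - mxC A) *m (X *m resolvent lam w *m invmx X) = 1%:M.
    rewrite !mulmxA mulmxBl HAX mul_scalar_mx -mul_mx_scalar -mulmxBr.
    rewrite -(mulmxA X) (_ : _ *m resolvent lam w = 1%:M) ?mulmx1 ?mulmxV//.
    have -> : s%:M - diag_mx lam = diag_mx (\row_i (s - lam 0 i)).
      apply/matrixP => i j; rewrite !mxE.
      by case: eqVneq => [->|]; rewrite ?mulr1n ?mulr0n ?subr0.
    apply/matrixP => i j; rewrite /resolvent mul_diag_mx !mxE.
    case: eqVneq => [->|_]; last by rewrite !mulr0n mulr0.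
    by rewrite !mulr1n mulfV// (imag_sub_neq0 pole_Re_lt0).
  have [u _] := mulmx1_unit e.
  by rewrite -[LHS]mulmx1 -e (mulKmx u).
have trunc : modal_truncation lam (residue Bd Cd) alpha Da s =
    mxC Da + Cd *m diag_mx (mxC alpha)^T *m resolvent lam w *m Bd.
  rewrite /modal_truncation; congr (_ + _).
  rewrite -(mulmxA Cd); set d := \row_i ((alpha i 0)%:C * (s - lam 0 i)^-1).
  have -> : diag_mx (mxC alpha)^T *m resolvent lam w = diag_mx d.
    apply/matrixP => i j; rewrite /resolvent mul_diag_mx !mxE.
    by case: eqVneq => [->|_]; rewrite ?mulr1n// !mulr0n mulr0.
  rewrite diag_mx_sum_delta mulmx_sumr mulmx_suml; apply: eq_bigr => i _.
  rewrite scalerA /residue trmx_delta -(mulmxA Cd) mul_delta_mx.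
  by rewrite -scalemxAr -scalemxAl [d 0 i]mxE.
rewrite /transfer inv trunc /error_output /Cd /Bd.
rewrite [mxC (D - Da)]raddfB /= mulmxBr mulmx1 !mulmxBl !mulmxA.
by rewrite opprD addrA addrAC [RHS]addrA; congr (_ + _ ); rewrite addrAC.
Qed.

End ErrorModel.

(** * Equivalence of the two programs and existence of a solution *)

Section Truncation.
Local Open Scope classical_set_scope.
Local Open Scope complex_scope.
Local Open Scope sesquilinear_scope.
Context {R : realType} (n nu ny nc r : nat).
Context (A : 'M[R]_n) (B : 'M[R]_(n, nu)) (C : 'M[R]_(ny, n)) (D : 'M[R]_(ny, nu)).
Context (X : 'M[R[i]]_n) (lam : 'rV[R[i]]_n) (M : 'M[R]_(nc, n)).
Context (Hstable : stable (mxC A)) (HX : X \in unitmx)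
  (HAX : mxC A *m X = X *m diag_mx lam).

Let H := transfer (mxC A) (mxC B) (mxC C) (mxC D).
Let Bd := invmx X *m mxC B.
Let Cd := mxC C *m X.
Let Phi := residue Bd Cd.
Let err alpha Da := Hinf_norm (fun s => H s - modal_truncation lam Phi alpha Da s).
Let feasible := sdp_feasible r M lam Bd Cd D.
Let lam0 i : complex.Re (lam 0 i) < 0 := pole_Re_lt0 Hstable HX HAX i.
Let E alpha Da w := error_output C X alpha *m resolvent lam w *m Bd + mxC (D - Da).

Let errE alpha Da w :
    H (0 +i* w) - modal_truncation lam Phi alpha Da (0 +i* w) = E alpha Da w :=
  error_transfer B C D Hstable HX HAX alpha Da w.

Lemma err_leP alpha Da (c : R) : 0 <= c -> (err alpha Da <= c%:E)%E <->
  forall w (u : 'cV[R[i]]_nu),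
    rip (E alpha Da w *m u) (E alpha Da w *m u) <= c ^+ 2 * rip u u.
Proof.
move=> c0; split.
  move/(Hinf_norm_leP _ c0) => h w u; have := h w u.
  by rewrite errE.
move=> h; apply/(Hinf_norm_leP _ c0) => w u.
by rewrite errE; exact: h.
Qed.

Lemma err_fin alpha Da : exists2 c : R, 0 <= c & err alpha Da = c%:E.
Proof.
have [K K0 KP] := resolvent_bound lam0.
pose G := error_output C X alpha; pose Dm := mxC (D - Da).
(* The weight 1 in [rip_add_le] gives the factors 2; [b] bounds the squared gain and [1 + b] is at
   least its square root. *)
pose b := 2 * (rip G G * (K * rip Bd Bd)) + 2 * rip Dm Dm.
have b0 : 0 <= b.
  by rewrite addr_ge0// mulr_ge0// ?mulr_ge0// ?mulr_ge0// rip_ge0.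
have le : (err alpha Da <= (1 + b)%:E)%E.
  apply/err_leP => [|w u]; first by rewrite addr_ge0.
  have -> : E alpha Da w *m u = G *m (resolvent lam w *m (Bd *m u)) + Dm *m u.
    by rewrite /E mulmxDl !mulmxA.
  apply: (le_trans (rip_add_le _ _ ltr01)); rewrite invr1.
  apply: (@le_trans _ _ (b * rip u u)); last first.
    rewrite ler_wpM2r ?rip_ge0//; nra.
  have h1 := rip_mulmx_le Dm u.
  have : rip (G *m (resolvent lam w *m (Bd *m u))) (G *m (resolvent lam w *m (Bd *m u)))
      <= rip G G * (K * rip Bd Bd) * rip u u.
    apply: (le_trans (rip_mulmx_le _ _)); rewrite -mulrA ler_wpM2l ?rip_ge0//.
    by apply: (le_trans (KP _ _)); rewrite -mulrA ler_wpM2l// rip_mulmx_le.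
  rewrite /b; lra.
have := Hinf_norm_ge0 (fun s => H s - modal_truncation lam Phi alpha Da s).
rewrite -/(err alpha Da); case: (err alpha Da) le => [c|//|//] _.
by rewrite lee_fin => c0; exists c.
Qed.

Lemma feasible_err g P alpha Da : feasible g P alpha Da ->
  admissible r M alpha /\ (err alpha Da <= g%:E)%E.
Proof.
move=> [g0 /posdefP[hP _] adm neg]; split=> //.
apply/err_leP; first exact: ltW.
exact: (bounded_real_gain lam0 g0 hP neg).
Qed.

Lemma err_feasible alpha Da (h g : R) : admissible r M alpha ->
  0 <= h -> h < g -> (err alpha Da <= h%:E)%E ->
  exists P, feasible g P alpha Da.
Proof.
move=> adm h0 hg /(err_leP _ _ h0) gain.
have [P [pP nP]] := bounded_real_lemma lam0 h0 hg gain.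
by exists P; split => //; exact: le_lt_trans hg.
Qed.

(** The bounded real lemma as a statement on values: every level strictly above the norm is feasible
    and no level below it is. *)
Lemma inf_feasible alpha Da : admissible r M alpha ->
  ereal_inf [set h%:E | h in [set h : R | exists P, feasible h P alpha Da]]%classic
    = err alpha Da.
Proof.
move=> adm; have [c c0 ec] := err_fin alpha Da.
apply/eqP; rewrite eq_le; apply/andP; split; last first.
  by apply: le_ereal_inf_tmp => _ [h [P /feasible_err[_ eh]] <-].
rewrite ec; apply/lee_addgt0Pr => e e0; rewrite -EFinD.
apply: ge_ereal_inf; exists (c + e)%:E => //.
have [P fP] : exists P, feasible (c + e) P alpha Da.
  by apply: (err_feasible adm c0); rewrite ?ltrDl// ec.
by exists (c + e) => //; exists P.
Qed.

Lemma sdp_solution_err g alpha Da : sdp_solution r M lam Bd Cd D g alpha Da ->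
  admissible r M alpha /\ err alpha Da = g%:E.
Proof.
move=> [_ ge]; have adm : admissible r M alpha.
  have [[h [P fP]]|no] := pselect (exists h P, feasible h P alpha Da).
    by have [] := feasible_err fP.
  (* Without a feasible point the infimum would be [+oo], which is not a real [g]. *)
  move: ge; rewrite (_ : [set _ | _ in _]%classic = set0) ?ereal_inf0//.
  by apply/seteqP; split => // t [h [P fP] _]; case: no; exists h, P.
by split => //; rewrite -(inf_feasible _ adm).
Qed.

(** Eliminating [g] and [P] from the semidefinite program leaves the error norm as objective, so
    both programs minimise the same function of [alpha] and [Da]. *)
Lemma modal_solution_sdp alpha Da : modal_solution r M H lam Phi alpha Da <->
  exists g : R, sdp_solution r M lam Bd Cd D g alpha Da.
Proof.
split => [[adm opt]|[g sol]].
  have [g g0 eg] := err_fin alpha Da; exists g.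
  have infE : g%:E = ereal_inf [set h%:E | h in
      [set h : R | exists P, feasible h P alpha Da]]%classic.
    by rewrite inf_feasible.
  split => //; apply/eqP; rewrite eq_le; apply/andP; split.
    apply: le_ereal_inf_tmp => _ [h [P [alpha' [Da' fP]]] <-].
    have [adm' eh] := feasible_err fP.
    by rewrite -eg; apply: le_trans eh; exact: opt.
  rewrite infE; apply: ereal_inf_le_tmp => _ [h [P fP] <-].
  by exists h => //; exists P, alpha, Da.
have [adm eg] := sdp_solution_err sol.
split=> [|alpha' Da' adm']; first exact: adm.
change (err alpha Da <= err alpha' Da')%E.
rewrite eg; have [-> _] := sol; rewrite -(inf_feasible Da' adm').
apply: ereal_inf_le_tmp => _ [h [P fP] <-].
by exists h => //; exists P, alpha', Da'.
Qed.

(** A sublevel set is an intersection, over frequencies and inputs, of closed conditions on [Da]. *)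
Lemma err_closed alpha c : 0 <= c ->
  closed [set v : 'rV[R]_(ny * nu) | (err alpha (vec_mx v) <= c%:E)%E]%classic.
Proof.
move=> c0.
rewrite (_ : [set _ | _]%classic = (\bigcap_(p in [set: R * 'cV[R[i]]_nu])
  ((fun v => rip (E alpha (vec_mx v) p.1 *m p.2) (E alpha (vec_mx v) p.1 *m p.2))
    @^-1` [set x | x <= c ^+ 2 * rip p.2 p.2]))%classic); last first.
  apply/seteqP; split => [v /(err_leP _ _ c0) h p _|v h]; first exact: h.
  by apply/(err_leP _ _ c0) => w u; exact: (h (w, u)).
apply: closed_bigI => -[w u] _ /=.
apply: preimage_closed; last exact: closed_le.
have Ec : mxcont (fun v : 'rV[R]_(ny * nu) => E alpha (vec_mx v) w *m u).
  apply: mxcontM; last exact: mxcont_cst.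
  apply: mxcontD; first exact: mxcont_cst.
  move=> i j; split; under eq_fun do rewrite !mxE /=.
    apply: fun_continuousD; first exact: cst_continuous.
    by apply: fun_continuousN; exact: coord_continuous.
  exact: cst_continuous.
by move=> v _; exact: (rip_continuous Ec Ec).
Qed.

Lemma err_bounded alpha c : 0 <= c -> exists b,
  forall v : 'rV[R]_(ny * nu), (err alpha (vec_mx v) <= c%:E)%E ->
  forall k, `|v 0 k| <= b.
Proof.
move=> c0; pose G := E alpha 0 0.
(* At frequency 0 and a unit input each entry of [G], the error for [Da = 0], differs in real part
   from that of [v] by at most [c], and that real part is at most [1 + rip G G] in absolute
   value. *)
exists (c + (1 + rip G G)) => v /(err_leP _ _ c0) h k.
case/mxvec_indexP: k => i j.
have := h 0 (delta_mx j 0); set z := _ *m _ => zc.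
have dj : rip (delta_mx j 0 : 'cV[R[i]]_nu) (delta_mx j 0) = 1.
  rewrite ripE (bigD1 j)//= big_ord1 big1 => [|k kj]; rewrite ?big_ord1 !mxE.
    by rewrite !eqxx /= mulr0 !addr0 mulr1.
  by rewrite (negPf kj) /= !mulr0 addr0.
have zE : complex.Re (z i 0) = complex.Re (G i j) - v 0 (mxvec_index i j).
  rewrite /z -colE mxE /G /E [(_ + mxC (D - vec_mx v)) i j]mxE ReD.
  by rewrite [(_ + mxC (D - 0)) i j]mxE ReD !mxE /= subr0 addrA.
have := rip_entry z i 0; have := rip_entry G i j; move: zc; rewrite dj zE mulr1.
move: (rip z z) (rip G G) (rip_ge0 G) (complex.Re (G i j)) (complex.Im (G i j)).
move: (complex.Im (z i 0)) (v 0 _) => y x zz gg gg0 a b zzc ag xz.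
have xc : (a - x) ^+ 2 <= c ^+ 2 by have := sqr_ge0 y; lra.
have : `|a - x| <= c by rewrite -ler_sqr ?nnegrE// real_normK ?num_real.
rewrite ler_norml => /andP[x1 x2].
have [a1 a2] : a <= 1 + gg /\ - a <= 1 + gg.
  have := sqr_ge0 b; have := sqr_ge0 (a - 1); have := sqr_ge0 (a + 1).
  by split; nra.
by rewrite ler_norml; apply/andP; split; lra.
Qed.

(** The sublevel sets above the infimum [m] generate a filter; a cluster point in the compact set
    [S (m + 1)] lies in all of them by closedness, so its error is at most [m]. *)
Lemma exists_best_feedthrough alpha : exists Da, forall Da', (err alpha Da <= err alpha Da')%E.
Proof.
pose S c := [set v : 'rV[R]_(ny * nu) | (err alpha (vec_mx v) <= c%:E)%E]%classic.
pose V := [set c : R | 0 <= c /\ exists Da, err alpha Da = c%:E]%classic.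
have [c1 c10 ec1] := err_fin alpha 0.
have V0 : (V !=set0)%classic by exists c1; split => //; exists 0.
have Vlb : has_lbound V by exists 0 => c [].
pose m := inf V.
have m0 : 0 <= m by apply: lb_le_inf => // c [].
have S0 c : m < c -> (S c !=set0)%classic.
  move=> /(inf_lt V0)[d [d0 [Da ed]] dc]; exists (mxvec Da).
  by rewrite /S /= mxvecK ed lee_fin ltW.
pose F := filter_from [set c | m < c]%classic S.
have Ff : Filter F.
  apply: filter_from_filter; first by exists (m + 1) => /=; rewrite ltrDl.
  move=> c d /= mc md; exists (Num.min c d); first by rewrite /= lt_min mc.
  move=> v; rewrite /S /= => h; split; apply: (le_trans h).
    by rewrite lee_fin ge_min lexx.
  by rewrite lee_fin ge_min lexx orbT.
have FP : ProperFilter F by apply: filter_from_proper => c; exact: S0.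
have m1 : 0 <= m + 1 by rewrite addr_ge0.
have Sc : compact (S (m + 1)).
  have [b hb] := err_bounded alpha m1.
  by apply: (@closed_box_compact _ _ _ b) => //; exact: err_closed.
have FS : F (S (m + 1)) by exists (m + 1) => //=; rewrite ltrDl.
have [v [_ vF]] := Sc F FP FS.
exists (vec_mx v) => Da'; have [d d0 ed] := err_fin alpha Da'.
have md : m <= d by apply: ge_inf => //; split => //; exists Da'.
rewrite ed; apply/lee_addgt0Pr => e e0; rewrite -EFinD.
have mde : m < d + e by rewrite (le_lt_trans md)// ltrDl.
apply: (@err_closed alpha _ (le_trans m0 (ltW mde)) v).
by move=> U vU; apply: vF vU; exists (d + e).
Qed.

Lemma exists_modal_solution : (exists alpha : 'cV[R]_n, admissible r M alpha) ->
  exists alpha Da, modal_solution r M H lam Phi alpha Da.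
Proof.
move=> [alpha0 adm0]; have [Dopt DoptP] := choice exists_best_feedthrough.
(* Admissible [alpha] are indexed by a finite type, on which a minimiser exists once each is given
   its best feedthrough. *)
pose al (b : {ffun 'I_n -> bool}) : 'cV[R]_n := \col_i (b i)%:R.
have alP alpha : admissible r M alpha -> exists b, alpha = al b.
  move=> [a01 _ _]; exists [ffun i => alpha i 0 == 1].
  apply/colP => i; rewrite mxE ffunE.
  by case: (a01 i) => ->; rewrite ?eqxx// eq_sym oner_eq0.
have [b0 b0E] := alP _ adm0.
have pb0 : `[< admissible r M (al b0) >] by rewrite -b0E; apply/asboolP.
case: (@arg_minP _ _ _ b0 (fun b => `[< admissible r M (al b) >])
  (fun b => err (al b) (Dopt (al b))) pb0) => b /asboolP bP bmin.
exists (al b), (Dopt (al b)); split=> [|alpha' Da' adm']; first exact: bP.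
change (err (al b) (Dopt (al b)) <= err alpha' Da')%E.
have [b' b'E] := alP _ adm'; apply: (le_trans _ (DoptP _ _)).
by rewrite b'E; apply: bmin; apply/asboolP; rewrite -b'E.
Qed.

End Truncation.

Theorem theorem4 (R : realType) (n nu ny nc r : nat)
    (A : 'M[R]_n) (B : 'M[R]_(n, nu)) (C : 'M[R]_(ny, n)) (D : 'M[R]_(ny, nu))
    (X : 'M[R[i]]_n) (lam : 'rV[R[i]]_n) (pr : 'I_nc -> 'I_n * 'I_n)
    (Hr : (0 < r < n)%N)
    (Hstable : stable (mxC A))
    (HX : X \in unitmx)
    (HAX : mxC A *m X = X *m diag_mx lam) :
  let H := transfer (mxC A) (mxC B) (mxC C) (mxC D) in
  let Bd := invmx X *m mxC B in
  let Cd := mxC C *m X in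
  let Phi := residue Bd Cd in
  let M := pair_mx R pr in
  conjugate_pairing lam Phi pr ->
  [/\ ((exists alpha : 'cV[R]_n, admissible r M alpha) ->
       exists (alpha : 'cV[R]_n) (Da : 'M[R]_(ny, nu)),
         modal_solution r M H lam Phi alpha Da),
      (forall (alpha : 'cV[R]_n) (Da : 'M[R]_(ny, nu)),
         modal_solution r M H lam Phi alpha Da <->
         exists g : R, sdp_solution r M lam Bd Cd D g alpha Da) &
      (forall (alpha : 'cV[R]_n) (Da : 'M[R]_(ny, nu)) (g : R),
         sdp_solution r M lam Bd Cd D g alpha Da ->
         Hinf_norm (fun s => H s - modal_truncation lam Phi alpha Da s)
           = g%:E)].

Proof.
move=> H Bd Cd Phi M _; split.
- exact: exists_modal_solution.
- by move=> alpha Da; exact: modal_solution_sdp.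
- by move=> alpha Da g /(sdp_solution_err Hstable HX HAX)[].
Qed.
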